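(* Every claw-free subcubic graph is $(1,1,2,3)$-packing colorable.
   Context: All graphs are finite and simple. A graph is subcubic if its maximum degree is at most $3$, and claw-free if it has no induced subgraph isomorphic to $K_{1,3}$. For a non-decreasing sequence $S=(a_1,\ldots,a_r)$ of positive integers, an $S$-packing coloring of a graph $G$ is a partition of $V(G)$ into (possibly empty) sets $A_1,\ldots,A_r$ such that, for every $i\in\{1,\ldots,r\}$, any two distinct vertices in $A_i$ are at distance greater than $a_i$ in $G$ (vertices in different components are at infinite distance). $G$ is $S$-packing colorable if it has an $S$-packing coloring. *)

(* Defs.v *)
From mathcomp Require Import all_boot.

Set Implicit Arguments.
Unset Strict Implicit.
Unset Printing Implicit Defensive.

(* A finite simple graph is a symmetric irreflexive relation e on a finType T
   of vertices. *)

Section Graph.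
Variables (T : finType) (e : rel T).

Definition degree (x : T) : nat := #|[set y | e x y]|.

Definition max_degree : nat := \max_(x : T) degree x.

Definition subcubic : bool := max_degree <= 3.

Definition induced_subgraph (U : finType) (h : rel U) : Prop :=
  exists f : U -> T, injective f /\ forall u v, e (f u) (f v) = h u v.

(* The star K_{1,3}, with centre ord0. *)
Definition K13 : rel 'I_4 := [rel i j | (i == ord0) != (j == ord0)].

Definition claw_free : Prop := ~ induced_subgraph K13.

Definition walk (k : nat) (x y : T) : bool :=
  [exists p : k.-tuple T, path e x p && (last x p == y)].

Lemma connect_walk x y : connect e x y -> exists k, walk k x y.
Proof.
case/connectP=> p ep ->; exists (size p).
by apply/existsP; exists (in_tuple p); rewrite ep eqxx.
Qed.

(* None stands for an infinite distance. *)
Definition dist (x y : T) : option nat :=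
  match boolP (connect e x y) with
  | AltTrue xy => Some (ex_minn (connect_walk xy))
  | AltFalse _ => None
  end.

Definition dist_gt (x y : T) (a : nat) : bool :=
  if dist x y is Some d then a < d else true.

Lemma dist_gtP x y a :
  reflect (forall p, path e x p -> last x p = y -> a < size p) (dist_gt x y a).
Proof.
rewrite /dist_gt /dist; case: {-}_ / boolP => [xy|nxy].
  case: ex_minnP => d wd dmin; apply: (iffP idP) => [ad p ep lp|gt_a].
    apply: leq_trans ad _; apply: dmin.
    by apply/existsP; exists (in_tuple p); rewrite ep lp eqxx.
  case/existsP: wd => q /andP[eq /eqP lq].
  by have := gt_a q eq lq; rewrite size_tuple.
apply: ReflectT => p ep lp; case/negP: nxy.
by apply/connectP; exists p.
Qed.

(* The classes are indexed from 0, so that A i is subject to the (i+1)-st term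
   of S; a class may be empty. *)
Definition packing_coloring (S : seq nat) (A : 'I_(size S) -> {set T}) : Prop :=
  [/\ \bigcup_i A i = [set: T],
      forall i j, i != j -> [disjoint A i & A j]
    & forall i x y, x \in A i -> y \in A i -> x != y ->
        dist_gt x y (nth 0 S i)].

Definition packing_colorable (S : seq nat) : Prop :=
  exists A : 'I_(size S) -> {set T}, packing_coloring A.

End Graph.

(* Main.v *)
Require Import Defs.
From mathcomp Require Import all_boot.

Set Implicit Arguments.
Unset Strict Implicit.
Unset Printing Implicit Defensive.

(** Call a pair (A, B) of disjoint vertex sets valid if distinct vertices of A
    are at distance greater than 2, distinct vertices of B at distance greater
    than 3, and R = A U B meets every triangle.  A valid pair for which the
    graph induced on the complement of R is bipartite is exactly what a
    (1,1,2,3)-packing coloring needs.  The proof produces some valid pair and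
    then repairs it until the complement is bipartite.

    _A first valid pair_ ([exists_valid]).  Call a vertex a center if it lies on
    an edge shared by two triangles, and let D be a maximal set of centers at
    pairwise distance greater than 2.  The triangles that miss D are pairwise
    disjoint, and by the degree bound each of their vertices has at most one
    neighbor outside its triangle.  Among them choose a maximal family I of triangles pairwise at
    distance greater than 2.  A triangle outside I has a vertex from which one
    leaves the triangle and reaches I within two steps; these vertices, together
    with D, form A.  From each triangle of I one vertex is put into B.  Two
    candidates in different triangles of I are at distance at most 3 only if
    they are joined by a path through two vertices outside these triangles, and
    claw-freeness makes this an equivalence relation with classes of size at
    most 3.  As every triangle offers 3 candidates, Hall's theorem ([regular_transversal]) gives a
    choice without conflict.

    _The repair_ ([valid_two_colorable]).  Since R meets all triangles,
    claw-freeness leaves every vertex outside R at most two neighbors outside R.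
    Hence the complement of R consists of paths and cycles; its core is the
    union of the cycles.  Let K be the core.  If some r in R has three neighbors
    in K, these form a path whose middle vertex b can be added to A when r is in
    B, and to B when r is in A, except that in the second case a vertex of B may
    be too close to b.  If some v in K has no neighbor in R, it can be added to A
    unless a vertex of A is too close to v.  If the cases are tried in
    this order, with r in B before r in A, then in the exceptional ones the
    obstructing vertex s is adjacent to exactly two vertices of K, which are
    adjacent to each other, and s can be exchanged for one of them.  This opens
    a cycle and closes none ([core_swap]), so the core always shrinks.  When
    no such step applies, every vertex of K shares its neighbor in R with
    exactly one of its two neighbors in K.  The edges of K are then the union of
    two matchings, so K is bipartite, and with it the complement of R. *)

(** * Hall's theorem and transversals *)

Section Hall.
Variables (A B : finType) (b0 : B).

Definition hall (I : {set A}) (F : A -> {set B}) :=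
  [forall J : {set A}, (J \subset I) ==> (#|J| <= #|\bigcup_(j in J) F j|)].

Lemma hallP (I : {set A}) (F : A -> {set B}) :
  reflect (forall J : {set A}, J \subset I -> #|J| <= #|\bigcup_(j in J) F j|)
          (hall I F).
Proof.
by apply: (iffP forallP) => H J; [move/implyP: (H J) | apply/implyP/H].
Qed.

Definition remove_at (F : A -> {set B}) i x j :=
  if j == i then F i :\ x else F j.

Lemma bigcup_remove_at (F : A -> {set B}) i x (J : {set A}) : i \notin J ->
  \bigcup_(j in J) remove_at F i x j = \bigcup_(j in J) F j.
Proof.
move=> iJ; apply: eq_bigr => j jJ; rewrite /remove_at.
by case: eqP => // ji; rewrite -ji jJ in iJ.
Qed.

(** A deletion that destroys the condition leaves a tight family J, and only
    a family containing [i] can have lost something. *)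
Lemma hall_violation (I : {set A}) (F : A -> {set B}) i x : hall I F ->
  ~~ hall I (remove_at F i x) ->
  exists2 J : {set A}, (J \subset I) && (i \notin J) &
    #|F i :\ x :|: \bigcup_(j in J) F j| <= #|J|.
Proof.
move/hallP=> HF /forallPn[J]; rewrite negb_imply -ltnNge => /andP[JI lt].
have iJ : i \in J.
  by apply/negPn/negP=> iJ; move: lt; rewrite bigcup_remove_at // ltnNge HF.
exists (J :\ i); first by rewrite setD11 andbT (subset_trans (subsetDl _ _)).
move: lt; rewrite (big_setD1 i) //= bigcup_remove_at ?setD11 // {1}/remove_at eqxx.
by rewrite (cardsD1 i J) iJ.
Qed.

(** Rado's proof.  While some [F i] has two elements [x] and [y], one of them
    can be deleted: if neither could, tight families J and L for the two
    deletions would violate the condition for [i |: J :|: L] or for [J :&: L],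
    by submodularity of the size of a union.  Once all [F i] are singletons,
    the condition for pairs is injectivity. *)
Theorem hall_marriage (I : {set A}) (F : A -> {set B}) : hall I F ->
  exists f : A -> B, {in I &, injective f} /\ {in I, forall i, f i \in F i}.
Proof.
have [n] := ubnP (\sum_(i in I) #|F i|); elim: n F => // n IHn F leFn HF.
have F1 i : i \in I -> 0 < #|F i|.
  move=> iI; have := hallP _ _ HF [set i]; rewrite big_set1 cards1; apply.
  by rewrite sub1set.
case: (boolP [exists i in I, 1 < #|F i|]) => [/existsP[i /andP[iI Fi]]|small].
  case/card_gt1P: (Fi) => x [y [xF yF xy]].
  have rec z : z \in F i -> hall I (remove_at F i z) ->
      exists f : A -> B, {in I &, injective f} /\ {in I, forall i, f i \in F i}.
    move=> zF Hz; have [|f [injf fF]] := IHn (remove_at F i z) _ Hz.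
      rewrite -ltnS; apply: leq_trans leFn; rewrite ltnS.
      rewrite (big_setD1 i) //= [X in _ < X](big_setD1 i) //=.
      rewrite {1}/remove_at eqxx (cardsD1 z (F i)) zF -addSn leq_add //.
      by apply: leq_sum => j; rewrite !inE /remove_at => /andP[/negPf-> _].
    exists f; split=> // j jI; move: (fF j jI); rewrite /remove_at.
    by case: eqP => // ->; rewrite inE => /andP[].
  case: (boolP (hall I (remove_at F i x))) => [/(rec x xF)//|].
  case/(hall_violation HF)=> J /andP[JI iJ] cJ.
  case: (boolP (hall I (remove_at F i y))) => [/(rec y yF)//|].
  case/(hall_violation HF)=> L /andP[LI iL] cL.
  set P := _ :|: _ in cJ; set Q := _ :|: _ in cL.
  have PQ : #|i |: (J :|: L)| <= #|P :|: Q|.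
    have /(hallP _ _ HF) : i |: (J :|: L) \subset I.
      by rewrite !subUset sub1set iI JI LI.
    move/leq_trans; apply; apply: subset_leq_card; apply/bigcupsP=> j.
    rewrite !inE => /or3P[/eqP->|jJ|jL]; apply/subsetP=> b bF.
    - rewrite !inE bF andbT andbT.
      by case: (eqVneq b x) => [->|//]; rewrite xy !orbT.
    - by rewrite /P !inE; apply/orP; left; apply/orP; right; apply/bigcupP;
      exists j.
    by rewrite /Q !inE; apply/orP; right; apply/orP; right; apply/bigcupP;
      exists j.
  have PIQ : #|J :&: L| <= #|P :&: Q|.
    have /(hallP _ _ HF) : J :&: L \subset I by rewrite subIset // JI.
    move/leq_trans; apply; apply: subset_leq_card; apply/bigcupsP=> j.
    rewrite !inE => /andP[jJ jL]; apply/subsetP=> b bF; rewrite !inE.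
    by apply/andP; split; apply/orP; right; apply/bigcupP; exists j.
  (* Both sides count the union plus the intersection, and [i] makes the left
     one larger by 1 than the sizes of J and L allow. *)
  have := leq_add PQ PIQ; rewrite cardsUI cardsU1 !inE (negPf iJ) (negPf iL) /=.
  rewrite -addnA cardsUI add1n => /leq_trans/(_ (leq_add cJ cL)).
  by rewrite ltnn.
have {}F1 i : i \in I -> #|F i| = 1.
  move=> iI; apply/eqP; rewrite eqn_leq F1 // andbT leqNgt.
  by apply: contra small => Fi; apply/existsP; exists i; rewrite iI.
exists (fun i => odflt b0 [pick b in F i]); split=> [i j iI jI|i iI];
  last first.
  by case: pickP => // F0; move: (F1 i iI); rewrite (eq_card0 F0).
case: pickP => /= [b bi|F0]; last by move: (F1 i iI); rewrite (eq_card0 F0).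
case: pickP => /= [c cj|F0]; last by move: (F1 j jI); rewrite (eq_card0 F0).
move=> bc; apply/eqP/negPn/negP=> ij; rewrite -{}bc in cj.
have single k : k \in I -> b \in F k -> F k = [set b].
  move=> kI bk; apply/eqP; rewrite eq_sym eqEcard sub1set bk cards1.
  by rewrite F1.
have := hallP _ _ HF [set i; j]; rewrite subUset !sub1set iI jI cards2 ij.
rewrite bigcup_setU !big_set1 (single i) // (single j) // setUid cards1.
by move/(_ isT).
Qed.
End Hall.

Section Transversal.
Variables (T B : finType) (x0 : T).

(** Hall's condition holds by double counting: n members of the family have at
    least [k * n] elements in total, and each value of [kappa] accounts for at
    most [k] of them. *)
Lemma regular_transversal (I : {set {set T}}) (kappa : T -> B) (k : nat) :
    0 < k -> trivIset I -> {in I, forall t : {set T}, k <= #|t|} ->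
    (forall x, x \in cover I ->
      #|[set y in cover I | kappa y == kappa x]| <= k) ->
  exists f : {set T} -> T,
    {in I, forall t : {set T}, f t \in t} /\ {in I &, injective (kappa \o f)}.
Proof.
move=> k0 tI bigI smallK; pose F (t : {set T}) := kappa @: t.
have : hall I F.
  apply/hallP=> J JI; rewrite -(leq_pmul2l k0).
  apply: (@leq_trans #|cover J|).
    have /eqP<- : \sum_(t in J) #|t| == #|cover J| := trivIsetS JI tI.
    rewrite mulnC -sum_nat_const; apply: leq_sum => t tJ; apply: bigI.
    exact: subsetP tJ.
  pose N := \bigcup_(t in J) F t.
  apply: (@leq_trans (\sum_(b in N) #|[set x in cover J | kappa x == b]|)).
    rewrite -sum1_card (partition_big kappa (mem N)) /=.
      by apply: leq_sum => b _; rewrite -sum1_card; apply: eq_leq;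
        apply: eq_bigl => x; rewrite inE.
    move=> x /bigcupP[t tJ xt].
    by apply/bigcupP; exists t => //; apply: imset_f.
  rewrite mulnC -sum_nat_const;
    apply: leq_sum => b /bigcupP[t tJ /imsetP[x xt ->]].
  have tI' := subsetP JI _ tJ.
  apply: leq_trans (smallK x _); last by apply/bigcupP; exists t.
  apply: subset_leq_card; apply/subsetP=> y;
    rewrite !inE => /andP[/bigcupP[s sJ ys] ->].
  by rewrite andbT; apply/bigcupP; exists s => //; apply: (subsetP JI).
case/(hall_marriage (kappa x0)) => g [injg gF].
exists (fun t : {set T} => odflt x0 [pick x in t | kappa x == g t]).
have pickE (t : {set T}) : t \in I ->
    (odflt x0 [pick x in t | kappa x == g t] \in t) /\
    kappa (odflt x0 [pick x in t | kappa x == g t]) = g t.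
  move=> tI'; case: pickP => /= [x /andP[-> /eqP]//|no].
  by case/imsetP: (gF t tI') => x xt gx; move: (no x); rewrite /= xt gx eqxx.
split=> [t /pickE[]//|t s tI' sI /=].
by rewrite (pickE t tI').2 (pickE s sI).2; apply: injg.
Qed.
End Transversal.

(** * Maximal independent sets *)

Lemma maximal_independent (U : finType) (r : rel U) (M : {set U}) :
  symmetric r -> exists I : {set U},
  [/\ I \subset M, {in I &, forall x y, x != y -> ~~ r x y} &
      {in M, forall x, x \in I \/ exists2 y, y \in I & r x y}].
Proof.
move=> r_sym.
pose P (A : {set U}) := (A \subset M) &&
  [forall x in A, forall y in A, (x != y) ==> ~~ r x y].
have P0 : P set0.
  by rewrite /P sub0set; apply/forall_inP=> x; rewrite inE.
have [I /maxsetP[/andP[IM /forall_inP indI] maxI] _] := maxset_exists P0.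
have {}indI : {in I &, forall x y, x != y -> ~~ r x y}.
  by move=> x y xI yI; apply/implyP; move: y yI; apply/forall_inP/indI.
exists I; split=> // x xM; case: (boolP [exists y in I, r x y]) => [|far].
  by case/exists_inP=> y yI xy; right; exists y.
left; rewrite -(maxI (x |: I)) ?setU11 ?subsetUr //.
rewrite /P subUset sub1set xM IM; apply/forall_inP=> y yI;
  apply/forall_inP=> z zI.
have {}far w : w \in I -> ~~ r x w by move=> wI; apply: (exists_inPn far).
apply/implyP; move: yI zI; rewrite !inE => /orP[/eqP->|yI] /orP[/eqP->|zI] yz.
- by rewrite eqxx in yz.
- exact: far.
- by rewrite r_sym far.
exact: indI.
Qed.

(** * Two-colorings *)

Section TwoColoring.
Variable T : finType.
Implicit Types (e f : rel T) (K S Z : {set T}).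

Definition nbrs_in e K x := [set y in K | e x y].

Definition two_core e K := [forall x in K, 1 < #|nbrs_in e K x|].

Definition two_colorable e S :=
  exists c : T -> bool, {in S &, forall x y, e x y -> c x != c y}.

(** A vertex with at most one neighbor in [S] can be colored last, so that only
    the sets of minimum degree at least 2 matter. *)
Lemma two_colorable_peel e S : symmetric e -> irreflexive e ->
    (forall K, K \subset S -> two_core e K -> two_colorable e K) ->
  two_colorable e S.
Proof.
move=> e_sym e_irr; have [n] := ubnP #|S|; elim: n S => // n IHn S leS cores.
case: (boolP (two_core e S)) => [|/forallPn[x]]; first exact: cores.
rewrite negb_imply -leqNgt => /andP[xS degx].
have [||c cP] := IHn (S :\ x).
- by move: leS; rewrite (cardsD1 x S) xS.
- by move=> K KS; apply: cores; apply: subset_trans KS (subsetDl _ _).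
exists (fun y => if y == x then ~~ [exists z in nbrs_in e S x, c z] else c y).
have nbr y : y \in S -> e x y ->
    [exists z in nbrs_in e S x, c z] = c y /\ y != x.
  move=> yS xy; have yN : y \in nbrs_in e S x by rewrite inE yS.
  split; last by apply: contraTneq xy => ->; rewrite e_irr.
  apply/existsP/idP => [[z /andP[zN cz]]|cy]; last by exists y; rewrite yN.
  by rewrite (card_le1_eqP degx z y zN yN).
move=> y z yS zS /=; case: (y =P x) => [-> /(nbr z zS)[-> /negPf->]|/eqP yx].
  by case: (c z).
case: (z =P x) => [->|/eqP zx yz]; last by apply: cP; rewrite // !inE ?yx ?zx.
by rewrite e_sym => /(nbr y yS)[-> _]; case: (c y).
Qed.

(** The union of the perfect matching [m] and a partial matching [f] has only
    even cycles.  The induction contracts: a pair [x], [m x] is removed and the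
    [f]-partners of [x] and [m x] are joined by a new [f]-edge.  The new edge
    forces the two partners to get different colors, which is what allows
    [x] and [m x] to be colored. *)
Lemma two_colorable_matchings (m : T -> T) f S :
    {in S, forall x, m x \in S} -> {in S, involutive m} ->
    {in S, forall x, m x != x} -> symmetric f ->
    {in S, forall x, ~~ f x x} -> {in S & &, forall x y z, f x y -> f x z ->
      y = z} ->
  exists c : T -> bool,
    {in S, forall x, c (m x) != c x} /\ {in S &, forall x y, f x y ->
      c x != c y}.
Proof.
have [n] := ubnP #|S|; elim: n f S => // n IHn f S leS mS mK mN f_sym f_irr f1.
have [->|[x xS]] := set_0Vmem S.
  by exists (fun=> true); split=> x; rewrite inE.
pose S' := S :\ x :\ m x.
have S'P y : (y \in S') = [&& y != m x, y != x & y \in S] by rewrite !inE.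
have S'S y : y \in S' -> y \in S by rewrite S'P => /and3P[].
pose f' := [rel p q | [|| f p q, f x p && f (m x) q | f x q && f (m x) p]].
have mxS := mS x xS.
have xm_disj p : p \in S' -> ~~ (f x p && f (m x) p).
  move=> pS; apply/negP=> /andP[xp mp]; move: (mN x xS).
  by rewrite (f1 p (m x) x (S'S p pS) mxS xS) ?eqxx // f_sym.
have xm_disj' p : p \in S' -> f x p -> ~~ f (m x) p.
  by move=> pS xp; have := xm_disj p pS; rewrite xp.
have xm_disj'' p : p \in S' -> f (m x) p -> ~~ f x p.
  by move=> pS mp; have := xm_disj p pS; rewrite mp andbT.
have inner p q : p \in S' -> q \in S' -> f p q ->
    f x p = false /\ f (m x) p = false.
  move=> pS qS pq; split; apply/negP=> zp; move: (qS); rewrite S'P.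
    by rewrite (f1 p q x (S'S p pS) (S'S q qS) xS) ?eqxx ?andbF // f_sym.
  by rewrite (f1 p q (m x) (S'S p pS) (S'S q qS) mxS) ?eqxx // f_sym.
have S'm y : y \in S' -> m y \in S'.
  rewrite !S'P => /and3P[ymx yx yS]; rewrite mS // andbT.
  apply/andP; split; first by apply: contra yx => /eqP E;
    rewrite -(mK y) // E mK.
  by apply: contra ymx => /eqP E; rewrite -E mK.
have [|||||||c [cm cf]] := IHn f' S'.
- move: leS; rewrite (cardsD1 x S) xS (cardsD1 (m x) (S :\ x)) !inE mN ?mxS //.
  exact: ltnW.
- exact: S'm.
- by move=> y /S'S; apply: mK.
- by move=> y /S'S; apply: mN.
- by move=> p q; rewrite /= f_sym [X in _ || X]orbC.
- by move=> p pS; rewrite /= (negPf (f_irr p (S'S p pS))) /= orbb xm_disj.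
- move=> p q r pS qS rS; case/or3P=> [pq|/andP[xp mq]|/andP[xq mp]].
  + have [xp mp] := inner p q pS qS pq; rewrite /= xp mp andbF /= orbF.
    exact: (f1 p q r (S'S p pS) (S'S q qS) (S'S r rS)) pq.
  + rewrite /= xp (negPf (xm_disj' p pS xp)) andbF orbF => /orP[pr|mr].
      by have [] := inner p r pS rS pr; rewrite xp.
    by apply: (f1 (m x) q r mxS); rewrite ?S'S.
  rewrite /= mp (negPf (xm_disj'' p pS mp)) andbT /= => /orP[pr|xr].
    by have [] := inner p r pS rS pr; rewrite mp.
  by apply: (f1 x q r xS); rewrite ?S'S.
(* The color of [x] is dictated by its own partner, or else by that of [m x];
   when both exist, the new edge makes the two requirements agree. *)
pose cx := if [pick p in S' | f x p] is Some p then ~~ c p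
           else if [pick q in S' | f (m x) q] is Some q then c q else true.
have cx_x p : p \in S' -> f x p -> c p = ~~ cx.
  move=> pS xp; rewrite /cx; case: pickP => [q /andP[qS xq]|/(_ p)]; last first.
    by rewrite /= pS xp.
  by rewrite negbK (f1 x p q xS) ?S'S.
have cx_m q : q \in S' -> f (m x) q -> c q = cx.
  move=> qS mq; rewrite /cx; case: pickP => [p /andP[pS xp]|_].
    by have := cf p q pS qS; rewrite /= xp mq orbT => /(_ isT); case: (c p);
      case: (c q).
  case: pickP => [r /andP[rS mr]|/(_ q)]; last by rewrite /= qS mq.
  by rewrite (f1 (m x) q r mxS) ?S'S.
exists (fun y => if y == x then cx else if y == m x then ~~ cx else c y).
have outer y : y \in S -> [\/ y = x, y = m x | y \in S'].
  move=> yS; case: (eqVneq y x) => [->|yx]; first by constructor 1.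
  case: (eqVneq y (m x)) => [->|ymx]; first by constructor 2.
  by constructor 3; rewrite S'P yx ymx.
have S'E y : y \in S' -> (y == x = false) * (y == m x = false).
  by rewrite S'P => /and3P[/negPf-> /negPf->].
have mxx : (m x == x) = false by apply/negbTE/mN.
split=> [y /outer[->|->|yS]|y z /outer[->|->|yS] /outer[->|->|zS]];
  rewrite ?mK ?eqxx ?mxx ?(S'E y) ?(S'E z) ?S'm //.
- by case: (cx).
- by case: (cx).
- by rewrite !(S'E _ (S'm y yS)) cm.
- by rewrite (negPf (f_irr x xS)).
- by case: (cx).
- by move/(cx_x z zS)->; case: (cx).
- by case: (cx).
- by rewrite (negPf (f_irr _ mxS)).
- by move/(cx_m z zS)->; case: (cx).
- by rewrite f_sym => /(cx_x y yS)->; case: (cx).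
- by rewrite f_sym => /(cx_m y yS)->; case: (cx).
by move=> yz; apply: cf => //=; rewrite yz.
Qed.

(** Handshake lemma. *)
Lemma even_degree_sum e Z : symmetric e -> irreflexive e ->
  ~~ odd (\sum_(x in Z) #|nbrs_in e Z x|).
Proof.
move=> e_sym e_irr; have [n] := ubnP #|Z|; elim: n Z => // n IHn Z leZ.
have [->|[z zZ]] := set_0Vmem Z; first by rewrite big_set0.
have IH : ~~ odd (\sum_(x in Z :\ z) #|nbrs_in e (Z :\ z) x|).
  by apply: IHn; move: leZ; rewrite (cardsD1 z Z) zZ.
rewrite (big_setD1 z) //=.
have -> : \sum_(x in Z :\ z) #|nbrs_in e Z x| =
    \sum_(x in Z :\ z) e x z + \sum_(x in Z :\ z) #|nbrs_in e (Z :\ z) x|.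
  rewrite -big_split; apply: eq_bigr => x _ /=.
  rewrite (cardsD1 z (nbrs_in e Z x)) inE zZ; congr (_ + #|pred_of_set _|).
  by apply/setP=> y; rewrite !inE andbA.
have -> : \sum_(x in Z :\ z) e x z = #|nbrs_in e Z z|.
  rewrite -sum1_card big_mkcond [RHS]big_mkcond /=; apply: eq_bigr => x _.
  rewrite !inE e_sym; case: eqP => [->|_]; first by rewrite e_irr andbF.
  by case: (x \in Z); case: (e z x).
by rewrite addnA addnn oddD odd_double.
Qed.
End TwoColoring.

(** * Bounded distance *)

Section ClawFreeSubcubic.
Variables (T : finType) (e : rel T).
Hypothesis e_sym : symmetric e.
Hypothesis e_irr : irreflexive e.
Hypothesis deg_le3 : forall x, #|[set y | e x y]| <= 3.
Hypothesis e_claw_free : claw_free e.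

Lemma e_neq x y : e x y -> x != y.
Proof. by apply: contraTneq => ->; rewrite e_irr. Qed.

Lemma deg3 x a b c d : e x a -> e x b -> e x c -> e x d ->
  a != b -> a != c -> b != c -> [|| d == a, d == b | d == c].
Proof.
move=> xa xb xc xd ab ac bc; apply/negPn/negP;
  rewrite !negb_or => /and3P[da db dc].
have := deg_le3 x; rewrite (cardsD1 a) (cardsD1 b) (cardsD1 c) (cardsD1 d) !inE.
by rewrite xa xb xc xd da db dc (eq_sym b) (eq_sym c a) (eq_sym c b) ab ac bc.
Qed.

Lemma claw x a b c : e x a -> e x b -> e x c ->
  a != b -> a != c -> b != c -> [|| e a b, e a c | e b c].
Proof.
move=> xa xb xc ab ac bc; apply/negPn/negP;
  rewrite !negb_or => /and3P[/negPf nab /negPf nac /negPf nbc].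
have [[xa' xb'] xc'] := ((e_neq xa, e_neq xb), e_neq xc).
have U : uniq [:: x; a; b; c] by rewrite /= !inE !negb_or xa' xb' xc' ab ac bc.
apply: e_claw_free; exists (fun i : 'I_4 => nth x [:: x; a; b; c] i); split.
  by move=> i j /eqP; rewrite nth_uniq // => /eqP/val_inj.
move=> [[|[|[|[|i]]]] //= Hi] [[|[|[|[|j]]]] //= Hj];
  rewrite ?e_irr ?xa ?xb ?xc ?nab ?nac ?nbc //;
  by rewrite e_sym ?xa ?xb ?xc ?nab ?nac ?nbc.
Qed.

(** Having distance at most [k], in a form that unfolds one edge at a time. *)
Fixpoint near k x y :=
  (x == y) || (if k is k'.+1 then [exists z, e x z && near k' z y] else false).

Lemma near_refl k x : near k x x.
Proof. by case: k => [|k] /=; rewrite eqxx. Qed.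

Lemma near_step k x z y : e x z -> near k z y -> near k.+1 x y.
Proof. by move=> xz zy; apply/orP; right; apply/existsP; exists z;
  rewrite xz. Qed.

Lemma nearSP k x y :
  near k.+1 x y -> x = y \/ exists2 z, e x z & near k z y.
Proof.
case/orP=> [/eqP|/existsP[z /andP[xz zy]]]; first by left.
by right; exists z.
Qed.

Lemma near1 x y : e x y -> near 1 x y.
Proof. by move=> xy; apply: (near_step xy); apply: near_refl. Qed.

Lemma near2 x z y : e x z -> e z y -> near 2 x y.
Proof. by move=> xz zy; apply: (near_step xz); apply: near1. Qed.

Lemma near1P x y : near 1 x y -> x = y \/ e x y.
Proof.
case/nearSP=> [|[z xz]]; first by left.
by rewrite /= orbF => /eqP<-; right.
Qed.

Lemma near2P x y :
  near 2 x y -> [\/ x = y, e x y | exists2 z, e x z & e z y].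
Proof.
case/nearSP=> [|[z xz /near1P[<-|zy]]]; first by constructor 1.
  by constructor 2.
by constructor 3; exists z.
Qed.

Lemma nearW k x y : near k x y -> near k.+1 x y.
Proof.
elim: k x => [|k IHk] x; first by rewrite /= orbF => ->.
case/nearSP=> [->|[z xz /IHk]]; [exact: near_refl | exact: near_step].
Qed.

Lemma near_rcons k x z y : near k x z -> e z y -> near k.+1 x y.
Proof.
elim: k x => [|k IHk] x; first by rewrite /= orbF => /eqP-> /near1.
case/nearSP=> [-> zy|[w xw wz] zy]; last exact: near_step xw (IHk _ wz zy).
apply: (near_step zy); exact: near_refl.
Qed.

Lemma near_sym k x y : near k x y -> near k y x.
Proof.
elim: k x => [|k IHk] x; first by rewrite /= !orbF eq_sym.
case/nearSP=> [->|[z xz /IHk zy]]; first exact: near_refl.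
by apply: near_rcons zy _; rewrite e_sym.
Qed.

Lemma near_path k x p : path e x p -> size p <= k -> near k x (last x p).
Proof.
elim: p k x => [|z p IHp] k x /=; first by move=> _ _; apply: near_refl.
by case: k => // k /andP[xz zp] pk; apply: near_step xz _; apply: IHp.
Qed.

(** * Valid pairs and the core of their complement *)

Definition packed k (A : {set T}) :=
  {in A &, forall x y, x != y -> ~~ near k x y}.

Definition hits (R : {set T}) :=
  forall x y z, e x y -> e x z -> e y z -> [|| x \in R, y \in R | z \in R].

Definition valid k l (A B : {set T}) :=
  [/\ [disjoint A & B], packed k A, packed l B & hits (A :|: B)].

Lemma validC k l A B : valid k l A B -> valid l k B A.
Proof. by case=> d a b h; split; rewrite // 1?disjoint_sym // setUC. Qed.

(** The largest set outside [R] that induces minimum degree at least 2: when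
    [R] meets all triangles, the union of the cycles outside [R]. *)
Definition core (R : {set T}) :=
  \bigcup_(K : {set T} | [disjoint K & R] && two_core e K) K.

Lemma core_disjoint R : [disjoint core R & R].
Proof.
rewrite disjoint_sym; apply/bigcup_disjointP=> K /andP[].
by rewrite disjoint_sym.
Qed.

Lemma core_notin R x : x \in core R -> x \notin R.
Proof. by move=> xK; rewrite (disjointFr (core_disjoint R) xK). Qed.

Lemma core_two_core R : two_core e (core R).
Proof.
apply/forall_inP=> x /bigcupP[K KP xK];
  have /andP[_ /forall_inP/(_ x xK)] := KP.
move/leq_trans; apply; apply: subset_leq_card; apply/subsetP=> y.
rewrite !inE => /andP[yK ->]; rewrite andbT.
by apply/bigcupP; exists K.
Qed.

Lemma sub_core (K R : {set T}) : [disjoint K & R] -> two_core e K ->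
  K \subset core R.
Proof. by move=> d t; apply: bigcup_sup; rewrite d. Qed.

Lemma two_coreP K x : two_core e K -> x \in K ->
  exists p q, [/\ p \in K, q \in K, p != q, e x p & e x q].
Proof.
move/forall_inP=> tK /tK /card_gt1P[p [q]].
by rewrite !inE => -[/andP[pK xp] /andP[qK xq] pq]; exists p, q.
Qed.

Lemma core_add R b : b \in core R -> #|core (b |: R)| < #|core R|.
Proof.
move=> bK; apply: proper_card; apply/properP; split.
  apply: sub_core (core_two_core _).
  by apply: disjointWr (core_disjoint (b |: R)); apply: subsetUr.
by exists b => //; apply/negP=> /core_notin; rewrite setU11.
Qed.

Section Core.
Variable R : {set T}.
Hypothesis R_hits : hits R.
Let K := core R.

Lemma core_hits x y z : x \in K -> y \in K -> e x y -> e x z -> e y z ->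
  z \in R.
Proof.
move=> xK yK xy xz yz; move: (R_hits xy xz yz).
by rewrite (negPf (core_notin xK)) (negPf (core_notin yK)).
Qed.

Lemma core_triangle_free x y z :
  x \in K -> y \in K -> z \in K -> e x y -> e x z -> e y z = false.
Proof.
move=> xK yK zK xy xz; apply/negP=> yz; move: (core_notin zK).
by rewrite (core_hits xK yK).
Qed.

(** A third neighbor of [x] spans a triangle with [x] and one of its neighbors
    in the core, by claw-freeness; that triangle can only be met in the third
    neighbor. *)
Lemma core_nbrs x : x \in K -> exists p q,
  [/\ p \in K, q \in K, p != q, e x p & e x q] /\
  forall y, e x y -> y != p -> y != q -> y \in R /\ (e y p || e y q).
Proof.
move=> xK; have [p [q [pK qK pq xp xq]]] := two_coreP (core_two_core R) xK.
exists p, q; split=> // y xy yp yq; rewrite eq_sym in yp; rewrite eq_sym in yq.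
have := claw xp xq xy pq yp yq; rewrite (core_triangle_free xK) //= => H; split.
  by case/orP: H => H; [apply: core_hits xp _ _ | apply: core_hits xq _ _].
by rewrite ![e y _]e_sym.
Qed.

Lemma core_third x r : x \in K -> r \in R -> e x r -> exists p q,
  [/\ p \in K, q \in K, p != q, e x p & e x q] /\
  e r p /\ forall y, e x y -> [|| y == p, y == q | y == r].
Proof.
move=> xK rR xr; have [p [q [[pK qK pq xp xq] rest]]] := core_nbrs xK.
have rK y : y \in K -> r != y.
  by move=> yK; apply: contraTneq rR => ->; apply: core_notin.
have [_ /orP[rp|rq]] := rest r xr (rK p pK) (rK q qK).
  exists p, q; do 2!split=> //; move=> y xy; apply: (deg3 xp xq xr) => //.
    by rewrite eq_sym rK.
  by rewrite eq_sym rK.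
exists q, p; split; first by rewrite eq_sym.
split=> // y xy; apply: (deg3 xq xp xr) => //; rewrite eq_sym ?rK //.
Qed.

Lemma core_degree x : x \in K -> #|nbrs_in e K x| = 2.
Proof.
move=> xK; have [p [q [[pK qK pq xp xq] rest]]] := core_nbrs xK.
have -> : nbrs_in e K x = [set p; q].
  apply/setP=> y; rewrite !inE; apply/andP/orP=> [[yK xy]|[] /eqP-> //].
  case: (eqVneq y p) => yp; first by left.
  case: (eqVneq y q) => yq; first by right.
  by have [] := rest y xy yp yq; rewrite (negPf (core_notin yK)).
by rewrite cards2 pq.
Qed.

Lemma core_two_nbrs x p q y : x \in K -> p \in K -> q \in K -> y \in K ->
  e x p -> e x q -> e x y -> p != q -> (y == p) || (y == q).
Proof.
move=> xK pK qK yK xp xq xy pq; have := core_degree xK.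
rewrite (cardsD1 p) (cardsD1 q) (cardsD1 y) !inE pK qK yK xp xq xy eq_sym pq /=.
by case: (y == p); case: (y == q).
Qed.

Lemma core_closed x y : x \in K -> e x y -> y \notin R -> y \in K.
Proof.
move=> xK xy yR; have [p [q [[pK qK pq xp xq] rest]]] := core_nbrs xK.
case: (eqVneq y p) => [->//|yp]; case: (eqVneq y q) => [->//|yq].
by have [] := rest y xy yp yq; rewrite (negPf yR).
Qed.

(** The exchange of [s] for [z], where [z] and [z2] are the only neighbors of
    [s] in the core. *)

Section Swap.
Variables z z2 s : T.
Hypotheses (zK : z \in K) (z2K : z2 \in K).
Hypotheses (zz2 : e z z2) (sz : e s z) (sz2 : e s z2).
Hypothesis s_only : forall y, y \in K -> e s y -> y = z \/ y = z2.

(** A triangle that only [s] met contains [z], for otherwise, by the degree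
    bound, it consists of [s], [z2] and a further vertex outside [R], which would
    be a third neighbor of [s] in the core. *)
Lemma hits_swap : hits (z |: R :\ s).
Proof.
move=> x y w xy xw yw.
have step a b : e s a -> e s b -> e a b -> a \notin R -> b \notin R ->
    (a == z) || (b == z).
  move=> sa sb ab aR bR; apply/norP=> -[az bz].
  have aux c d : e s d -> e c d -> d \notin R -> d != z -> c != z2.
    move=> sd cd dR dz; apply/eqP=> cz2; rewrite {c}cz2 in cd.
    case: (s_only (core_closed z2K cd dR) sd) => dE;
      first by rewrite dE eqxx in dz.
    by rewrite dE e_irr in cd.
  have az2 : a != z2 := aux a b sb ab bR bz.
  have bz2 : b != z2 by apply: (aux b a sa _ aR az); rewrite e_sym.
  have := deg3 sz sz2 sa sb (e_neq zz2).
  rewrite eq_sym az eq_sym az2 (negPf bz) (negPf bz2) eq_sym (negPf (e_neq ab)).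
  by move/(_ isT isT).
have hit a b : e s a -> e s b -> e a b ->
    (a \in z |: R :\ s) || (b \in z |: R :\ s).
  move=> sa sb ab; rewrite !inE ![_ == s]eq_sym (e_neq sa) (e_neq sb) /=.
  case: (boolP (a \in R)) => aR; first by rewrite orbT.
  case: (boolP (b \in R)) => bR; first by rewrite !orbT.
  by rewrite !orbF step.
have keep a : a \in R -> a != s -> a \in z |: R :\ s.
  by move=> aR as_; rewrite !inE as_ aR orbT.
have xy' := xy; have xw' := xw; have yw' := yw.
rewrite e_sym in xy'; rewrite e_sym in xw'; rewrite e_sym in yw'.
case/or3P: (R_hits xy xw yw) => [xR|yR|wR].
- case: (eqVneq x s) => [E|/(keep x xR)->//].
  by rewrite E in xy xw; rewrite hit ?orbT.
- case: (eqVneq y s) => [E|/(keep y yR)->]; last by rewrite orbT.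
  by rewrite E in xy' yw; rewrite orbCA hit ?orbT.
case: (eqVneq w s) => [E|/(keep w wR)->]; last by rewrite !orbT.
by rewrite E in xw' yw'; rewrite orbA hit.
Qed.

(** The cycle through [z] is opened.  Suppose that [s] lies on a new cycle.  As
    [z] is removed, this cycle runs from [s] to [z2] and on along the old one, so
    the vertices of the old core that are not in the new one are joined to the
    others by the single edge between [z] and [z2].  They would induce a graph
    with one vertex of degree 1 and all others of degree 2, against the
    handshake lemma. *)
Lemma core_swap : #|core (z |: R :\ s)| < #|core R|.
Proof.
set R' := z |: R :\ s; set K' := core R'.
have zK' : z \notin K' by apply/negP=> /core_notin; rewrite setU11.
have K'R x : x \in K' -> x \in R -> x = s.
  move=> /core_notin xR' xR; apply/eqP/negPn/negP=> xs.
  by case/negP: xR'; rewrite !inE xs xR orbT.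
have K'_two := core_two_core R'.
apply: proper_card; apply/properP; split; last by exists z.
apply: sub_core => //.
have [sK'|sK'] := boolP (s \in K'); last first.
  apply/pred0P=> x /=; apply/negP=> /andP[xK' xR].
  by rewrite -(K'R x xK' xR) xK' in sK'.
have z_neq_z2 := e_neq zz2.
have z2K' : z2 \in K'.
  have [p [q [pK qK pq sp sq]]] := two_coreP K'_two sK'.
  case: (eqVneq p z2) => [<- //|pz2]; case: (eqVneq q z2) => [<- //|qz2].
  have pz : p != z by apply: contraNneq zK' => <-.
  have qz : q != z by apply: contraNneq zK' => <-.
  have := deg3 sz sz2 sp sq z_neq_z2; rewrite eq_sym pz eq_sym pz2.
  by rewrite (negPf qz) (negPf qz2) eq_sym (negPf pq) => /(_ isT isT).
(* [z z2] is the only edge of the old core that leaves the new one. *)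
have closed y w : y \in K -> y \in K' -> w \in K -> e y w ->
    (y == z2) && (w == z) || (w \in K').
  move=> yK yK' wK yw; apply/orP.
  have [a [b [aK' bK' ab ya yb]]] := two_coreP K'_two yK'.
  have inK c : c \in K' -> e y c -> c \in K \/ c = s /\ y = z2.
    move=> cK' yc; case: (boolP (c \in R)) => [cR|cR]; last first.
      by left; apply: core_closed yc cR.
    have cs := K'R c cK' cR; right; split=> //.
    case: (s_only yK) => [|yz|//]; first by rewrite -cs e_sym.
    by rewrite -yz yK' in zK'.
  have notz c : c \in K' -> c != z by apply: contraTneq => ->.
  case: (eqVneq y z2) => [yz2|yz2]; last first.
    right; have [aK|[_ E]] := inK a aK' ya; last by rewrite E eqxx in yz2.
    have [bK|[_ E]] := inK b bK' yb; last by rewrite E eqxx in yz2.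
    by case/orP: (core_two_nbrs yK aK bK wK ya yb yw ab) => /eqP->.
  case: (eqVneq w z) => [wz|wz]; [by left | right].
  have yz : e y z by rewrite yz2 e_sym.
  have isw c : c \in K' -> e y c -> c \in K -> w \in K'.
    move=> cK' yc cK; have := core_two_nbrs yK zK wK cK yz yw yc.
    by rewrite eq_sym wz (negPf (notz c cK')) => /(_ isT)/eqP<-.
  have [/(isw a aK' ya)//|[as_ _]] := inK a aK' ya.
  have [/(isw b bK' yb)//|[bs _]] := inK b bK' yb.
  by rewrite as_ bs eqxx in ab.
pose Z := K :\: K'.
have zZ : z \in Z by rewrite inE zK zK'.
have z_deg : #|nbrs_in e Z z| = 1.
  have -> : nbrs_in e Z z = nbrs_in e K z :\ z2.
    apply/setP=> y; rewrite !inE.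
    case: (boolP (y \in K)) => yK; rewrite ?andbF //= andbT.
    case: (boolP (e z y)) => zy; rewrite ?andbF // !andbT.
    case: (eqVneq y z2) => [->|yz2] /=; first by rewrite z2K'.
    apply/negP=> yK'; have := closed y z yK yK' zK.
    by rewrite e_sym zy (negPf yz2) (negPf zK') => /(_ isT).
  by have := core_degree zK; rewrite (cardsD1 z2) inE z2K zz2 => -[].
have Z_deg y : y \in Z :\ z -> #|nbrs_in e Z y| = 2.
  rewrite !inE => /and3P[yz yK' yK]; rewrite -(core_degree yK);
    congr #|pred_of_set _|.
  apply/setP=> w; rewrite !inE.
  case: (boolP (w \in K)) => wK; rewrite ?andbF //= andbT.
  case: (boolP (e y w)) => yw; rewrite ?andbF // !andbT.
  apply/negP=> wK'; have := closed w y wK wK' yK.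
  by rewrite e_sym yw (negPf yz) andbF (negPf yK') => /(_ isT).
have := even_degree_sum Z e_sym e_irr; rewrite (big_setD1 z) //= z_deg.
by rewrite (eq_bigr _ Z_deg) sum_nat_const muln2 add1n /= odd_double.
Qed.
End Swap.

(** Each of the three neighbors of [r] is adjacent to another one, and they do
    not form a triangle: they form a path with middle vertex [b]. *)
Lemma core_triple r : r \in R -> 2 < #|nbrs_in e K r| -> exists b u v,
  [/\ b \in K, u \in K & v \in K] /\ [/\ e r b, e r u & e r v] /\
  [/\ e b u, e b v & u != v].
Proof.
move=> rR /card_gt2P[x [y [w [[]]]]]; rewrite !inE.
move=> /andP[xK rx] /andP[yK ry] /andP[wK rw] [xy yw wx].
have nbr a b c : a \in K -> e r a -> e r b -> e r c -> a != b -> a != c ->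
    b != c -> e a b || e a c.
  move=> aK ra rb rc ab ac bc.
  have ar : e a r by rewrite e_sym.
  have [p [q [[pK _ _ ap _] [rp _]]]] := core_third aK rR ar.
  case/or3P: (deg3 ra rb rc rp ab ac bc) => /eqP E; move: ap;
    rewrite E ?e_irr //.
  - by move=> ->.
  by move=> ->; rewrite orbT.
rewrite eq_sym in wx.
case: (boolP (e x y)) => exy.
  have /orP[wx'|wy'] : e w x || e w y by apply: nbr; rewrite // eq_sym.
    by exists x, y, w; do !split=> //; rewrite e_sym.
  by exists y, x, w; do !split=> //; rewrite e_sym.
have := nbr x y w xK rx ry rw xy wx yw; rewrite (negPf exy) /= => exw.
have := nbr y x w yK ry rx rw; rewrite eq_sym xy yw wx e_sym (negPf exy) /=.
move=> /(_ isT isT isT) eyw.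
by exists w, x, y; do !split=> //; rewrite e_sym.
Qed.

Lemma triple_end r b u v :
    r \in R -> b \in K -> u \in K -> v \in K -> e r b -> e r u -> e r v ->
    e b u -> e b v -> u != v ->
  exists2 z, [/\ z \in K, e u z & z != b] &
    forall y, e u y -> [|| y == b, y == z | y == r].
Proof.
move=> rR bK uK vK rb ru rv bu bv uv.
have ur : e u r by rewrite e_sym.
have [p [q [[pK qK pq up uq] [rp rest]]]] := core_third uK rR ur.
have pb : p = b.
  case/or3P: (deg3 rb ru rv rp (e_neq bu) (e_neq bv) uv) => /eqP // E.
    by rewrite E e_irr in up.
  by rewrite E (core_triangle_free bK uK vK) in up.
by exists q; rewrite -?pb // eq_sym.
Qed.

End Core.

(** * Shrinking the core *)

Definition improvable k l A B := exists A' B',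
  valid k l A' B' /\ #|core (A' :|: B')| < #|core (A :|: B)|.

Lemma improvableC k l A B : improvable k l A B -> improvable l k B A.
Proof.
case=> A' [B' [/validC v lt]]; exists B', A'; split=> //.
by rewrite setUC [X in _ < #|core X|]setUC.
Qed.

Lemma packed_add k A b : packed k A -> {in A, forall s, ~~ near k b s} ->
  packed k (b |: A).
Proof.
move=> pA far x y; rewrite !inE => /orP[/eqP->|xA] /orP[/eqP->|yA] xy.
- by rewrite eqxx in xy.
- exact: far.
- by apply/negP => /near_sym; apply/negP/far.
exact: pA.
Qed.

Lemma improve_add k l A B b : valid k l A B -> b \in core (A :|: B) ->
  {in A, forall s, ~~ near k b s} -> improvable k l A B.
Proof.
case=> dAB pA pB AB_hits bK far; exists (b |: A), B; split; last first.
  by rewrite -setUA; apply: core_add.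
have /norP[bA bB] : ~~ ((b \in A) || (b \in B)).
  by have := core_notin bK; rewrite inE.
split=> //; last by move=> x y z xy xz yz; rewrite -setUA 3!in_setU1;
  case/or3P: (AB_hits x y z xy xz yz) => ->; rewrite !orbT.
- rewrite disjoints_subset; apply/subsetP=> y;
  rewrite !inE => /orP[/eqP->//|yA].
  by rewrite (disjointFr dAB yA).
exact: packed_add.
Qed.

Lemma improve_swap k l A B z z2 s :
    valid k l A B -> s \in A ->
    z \in core (A :|: B) -> z2 \in core (A :|: B) -> 
    e z z2 -> e s z -> e s z2 ->
    (forall y, y \in core (A :|: B) -> e s y -> y = z \/ y = z2) ->
    {in A, forall s', s' != s -> ~~ near k z s'} ->
  improvable k l A B.
Proof.
case=> dAB pA pB AB_hits sA zK z2K zz2 sz sz2 s_only far.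
have sB : s \notin B by rewrite (disjointFr dAB sA).
have E : (z |: A :\ s) :|: B = z |: (A :|: B) :\ s.
  apply/setP=> y; rewrite !inE -orbA; congr (_ || _).
  by case: eqP => [->|_] //=; rewrite (negPf sB).
exists (z |: A :\ s), B; rewrite E; split; last exact: core_swap s_only.
have /norP[zA zB] : ~~ ((z \in A) || (z \in B)).
  by have := core_notin zK; rewrite inE.
split=> //; last by rewrite E; apply: hits_swap s_only.
- rewrite disjoints_subset; apply/subsetP=> y;
  rewrite !inE => /orP[/eqP->//|/andP[_ yA]].
  by rewrite (disjointFr dAB yA).
apply: packed_add => [x y|s'];
  first by rewrite !inE => /andP[_ xA] /andP[_ yA]; apply: pA.
by rewrite !inE => /andP[s's s'A]; apply: far.
Qed.


Lemma nbrs_in_le2 K s z z2 : #|nbrs_in e K s| <= 2 -> z \in K -> z2 \in K ->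
  e s z -> e s z2 -> z != z2 -> forall y, y \in K -> e s y -> y = z \/ y = z2.
Proof.
move=> le2 zK z2K sz sz2 zz2 y yK sy.
case: (eqVneq y z) => yz; first by left.
case: (eqVneq y z2) => yz2; first by right.
move: le2; rewrite leqNgt => /negP[]; apply/card_gt2P; exists y, z, z2.
by rewrite !inE yK zK z2K sy sz sz2 yz zz2 eq_sym yz2.
Qed.

Lemma core_notinU A B y : y \in core (A :|: B) -> (y \notin A) * (y \notin B).
Proof. by move/core_notin; rewrite inE => /norP[]. Qed.

Lemma core_neql A B y s : y \in core (A :|: B) -> s \in A -> (s == y) = false.
Proof. by move=> yK; apply: contraTF => /eqP->; rewrite (core_notinU yK). Qed.

Lemma core_neqr A B y s : y \in core (A :|: B) -> s \in B -> (s == y) = false.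
Proof. by move=> yK; apply: contraTF => /eqP->; rewrite (core_notinU yK). Qed.

(** Within distance 2 of the middle vertex [b] of the path on the neighbors of
    [r] there are only [r] and vertices of the core, so [b] can join [A]. *)
Lemma improve_triple_r A B r : valid 2 3 A B -> r \in B ->
  2 < #|nbrs_in e (core (A :|: B)) r| -> improvable 2 3 A B.
Proof.
move=> vAB rB; have [dAB pA pB AB_hits] := vAB; set K := core _ => deg_r.
have rR : r \in A :|: B by rewrite inE rB orbT.
have [b [u [v [[bK uK vK] [[rb ru rv] [bu bv uv]]]]]] :=
  core_triple AB_hits rR deg_r.
have vu : v != u by rewrite eq_sym.
have [z [zK uz zb] Nu] := triple_end AB_hits rR bK uK vK rb ru rv bu bv uv.
have [w [wK vw wb] Nv] := triple_end AB_hits rR bK vK uK rb rv ru bv bu vu.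
have br : e b r by rewrite e_sym.
have KA y s : y \in K -> s \in A -> (s == y) = false := @core_neql A B y s.
have Ar s : s \in A -> s == r = false.
  by move=> sA; apply: contraTF rB => /eqP<-; rewrite (disjointFr dAB sA).
have rK y : y \in K -> y != r.
  by move=> yK; apply: contraTneq rB => <-; rewrite (core_notinU yK).
have Nb s : e b s -> [|| s == u, s == v | s == r].
  by move=> bs; apply: (deg3 bu bv br bs uv); apply: rK.
have Nr s : e r s -> [|| s == b, s == u | s == v].
  by move=> rs; apply: (deg3 rb ru rv rs _ _ uv); apply: e_neq.
apply: (improve_add vAB bK) => s sA; apply/negP=> /near2P[bs|/Nb|[y /Nb]].
- by have := KA b s bK sA; rewrite bs eqxx.
- by rewrite Ar // !KA.
case/or3P=> /eqP-> => [/Nu|/Nv|/Nr]; by rewrite ?Ar // ?KA.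
Qed.

(** Here [b] is the middle vertex of the path on the neighbors of [r] and [u] an
    end of it.  The vertex [s] is adjacent to the next vertex [z] of the cycle
    after [u], and thus also to the one after [z].  What lies within distance 3
    of [z] is either as close to [s], or else near [u], where apart from [s] only
    [r] and vertices of the core are found; so [z] can replace [s] in [B]. *)
Lemma improve_triple_end A B r b u v s : valid 2 3 A B -> r \in A ->
    {in B, forall s, #|nbrs_in e (core (A :|: B)) s| <= 2} ->
    b \in core (A :|: B) -> u \in core (A :|: B) -> v \in core (A :|: B) ->
    e r b -> e r u -> e r v -> e b u -> e b v -> u != v ->
    s \in B -> near 2 u s ->
  improvable 2 3 A B.
Proof.
move=> vAB rA; have [dAB pA pB AB_hits] := vAB; set K := core _.
move=> deg_B bK uK vK rb ru rv bu bv uv sB us.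
have rR : r \in A :|: B by rewrite inE rA.
have br : e b r by rewrite e_sym.
have KB y t : y \in K -> t \in B -> (t == y) = false := @core_neqr A B y t.
have Br t : t \in B -> t == r = false.
  by move=> tB; apply: contraTF rA => /eqP<-; rewrite (disjointFl dAB tB).
have rK y : y \in K -> y != r.
  by move=> yK; apply: contraTneq rA => <-; rewrite (core_notinU yK).
have Nb t : e b t -> [|| t == u, t == v | t == r].
  by move=> bt; apply: (deg3 bu bv br bt uv); apply: rK.
have Nr t : e r t -> [|| t == b, t == u | t == v].
  by move=> rt; apply: (deg3 rb ru rv rt _ _ uv); apply: e_neq.
have [z [zK uz zb] Nu] := triple_end AB_hits rR bK uK vK rb ru rv bu bv uv.
have zs : e z s.
  case/near2P: us => [us|/Nu|[y /Nu/or3P[]/eqP-> //]].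
  - by have := KB u s uK sB; rewrite us eqxx.
  - by rewrite Br // !KB.
  - by move/Nb; rewrite Br // !KB.
  by move/Nr; rewrite !KB.
have sR : s \in A :|: B by rewrite inE sB orbT.
have [p [q [[pK qK pq zp zq] [sp Nz]]]] := core_third AB_hits zK sR zs.
have zu : e z u by rewrite e_sym.
have qu : q = u.
  case/or3P: (Nz u zu) => /eqP E //.
    have /Nu : e u s by rewrite E e_sym.
    by rewrite Br // !KB.
  by have := KB u s uK sB; rewrite E eqxx.
have sz : e s z by rewrite e_sym.
have := improve_swap (validC vAB) sB; rewrite [B :|: A]setUC => swap.
apply/improvableC; apply: (swap z p) => //.
  exact: nbrs_in_le2 (deg_B s sB) zK pK sz sp (e_neq zp).
move=> t tB ts; apply/negP; rewrite eq_sym in ts.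
case/nearSP=> [zt|[y /Nz/or3P[]/eqP->]].
- by have := KB z t zK tB; rewrite zt eqxx.
- by move=> pt; case/negP: (pB s t sB tB ts); apply: near_step sp pt.
- rewrite qu; case/near2P => [ut|/Nu|[w /Nu/or3P[]/eqP->]].
  + by have := KB u t uK tB; rewrite ut eqxx.
  + by rewrite Br // !KB.
  + by move/Nb; rewrite Br // !KB.
  + by move/Nz; rewrite qu [t == s]eq_sym (negPf ts) !KB.
  by move/Nr; rewrite !KB.
by move/nearW => st; case/negP: (pB s t sB tB ts).
Qed.

(** The middle vertex [b] joins [B], unless some [s] in [B] is within distance 3
    of [b]; such an [s] is within distance 2 of an end of the path. *)
Lemma improve_triple_l A B r : valid 2 3 A B -> r \in A ->
    2 < #|nbrs_in e (core (A :|: B)) r| ->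
    {in B, forall s, #|nbrs_in e (core (A :|: B)) s| <= 2} ->
  improvable 2 3 A B.
Proof.
move=> vAB rA; have [dAB pA pB AB_hits] := vAB => deg_r deg_B.
have rR : r \in A :|: B by rewrite inE rA.
have [b [u [v [[bK uK vK] [[rb ru rv] [bu bv uv]]]]]] :=
  core_triple AB_hits rR deg_r.
have vu : v != u by rewrite eq_sym.
have side := improve_triple_end vAB rA deg_B bK.
case: (boolP [exists s in B, near 3 b s]) =>
  [/existsP[s /andP[sB]]|/exists_inPn far];
  last by apply/improvableC/(improve_add (validC vAB) (b := b));
    rewrite // setUC.
have br : e b r by rewrite e_sym.
have r_neq y : y \in core (A :|: B) -> y != r.
  by move=> yK; apply: contraTneq rA => <-; rewrite (core_notinU yK).
case/nearSP=> [bs|[y by_ ys]];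
  first by rewrite -bs (negPf (core_notinU bK).2) in sB.
case/or3P: (deg3 bu bv br by_ uv (r_neq u uK) (r_neq v vK)) => /eqP E.
- by apply: (side u v s); rewrite // -E.
- by apply: (side v u s); rewrite // -E.
have {E} rs : near 2 r s by rewrite -E.
(* The neighbors of [r] are [b] and the two ends of the path, so from [r] the
   vertex [s] is reached through one of these or past them. *)
case/near2P: rs => [rs|rs|[w rw ws]].
- by have := disjointFr dAB rA; rewrite rs sB.
- case/or3P: (deg3 rb ru rv rs (e_neq bu) (e_neq bv) uv) => /eqP E.
  + by rewrite E (negPf (core_notinU bK).2) in sB.
  + by rewrite E (negPf (core_notinU uK).2) in sB.
  by rewrite E (negPf (core_notinU vK).2) in sB.
case/or3P: (deg3 rb ru rv rw (e_neq bu) (e_neq bv) uv) => /eqP E;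
  rewrite E in ws.
- by apply: (side u v s) => //; apply: near2 ws; rewrite e_sym.
- by apply: (side u v s) => //; apply/nearW/near1.
by apply: (side v u s) => //; apply/nearW/near1.
Qed.

(** An obstructing [s] at distance 2 from [v] is adjacent to a neighbor [x] of
    [v] and hence to the other neighbor [p] of [x] in the core.  The
    neighbors of [x] are [v], [s] and [p], and those of [v] lie in the core, so
    whatever is within distance 2 of [x] is in the core or as close to [s]. *)
Lemma improve_no_neighbor k A B v : valid 2 k A B ->
    {in A, forall s, #|nbrs_in e (core (A :|: B)) s| <= 2} ->
    v \in core (A :|: B) -> (forall y, e v y -> y \in core (A :|: B)) ->
  improvable 2 k A B.
Proof.
move=> vAB; have [dAB pA pB AB_hits] := vAB; set K := core _ => deg_A vK Nv.
have KA y s : y \in K -> s \in A -> (s == y) = false := @core_neql A B y s.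
case: (boolP [exists s in A, near 2 v s]) =>
  [/existsP[s /andP[sA]]|/exists_inPn far];
  last exact: improve_add vAB vK far.
case/near2P=> [vs|/Nv sK|[x vx xs]].
- by have := KA v s vK sA; rewrite vs eqxx.
- by have := KA s s sK sA; rewrite eqxx.
have xK := Nv x vx; have sR : s \in A :|: B by rewrite inE sA.
have [p [q [[pK qK pq xp xq] [sp Nx]]]] := core_third AB_hits xK sR xs.
have qv : q = v.
  have xv : e x v by rewrite e_sym.
  case/or3P: (Nx v xv) => /eqP E //.
    have /Nv sK : e v s by rewrite E e_sym.
    by have := KA s s sK sA; rewrite eqxx.
  by have := KA v s vK sA; rewrite E eqxx.
have sx : e s x by rewrite e_sym.
apply: (improve_swap vAB sA xK pK xp sx sp).
  exact: nbrs_in_le2 (deg_A s sA) xK pK sx sp (e_neq xp).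
move=> s' s'A s's; apply/negP; rewrite eq_sym in s's.
case/near2P=> [xs'|/Nx|[y /Nx/or3P[]/eqP->]].
- by have := KA x s' xK s'A; rewrite xs' eqxx.
- by rewrite [s' == s]eq_sym (negPf s's) !KA.
- by move=> ps'; case/negP: (pA s s' sA s'A s's); apply: near2 sp ps'.
- by rewrite qv => /Nv s'K; have := KA s' s' s'K s'A; rewrite eqxx.
by move=> ss'; case/negP: (pA s s' sA s'A s's); apply/nearW/near1.
Qed.

(** Each vertex of the core is matched with the one neighbor in the core with
    which it has a common neighbor in [R]; the other edges form the second matching. *)
Lemma two_colorable_core R : hits R ->
    {in R, forall s, #|nbrs_in e (core R) s| <= 2} ->
    {in core R, forall v, exists2 r, r \in R & e v r} ->
  two_colorable e (core R).
Proof.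
move=> R_hits deg_R third; set K := core R in deg_R third *.
pose m y := odflt y [pick w in K | e y w && [exists r in R, e r y && e r w]].
have mP y : y \in K -> exists r q,
    [/\ r \in R, e r y, e r (m y) & forall r', r' \in R -> e y r' -> r' = r] /\
    [/\ m y \in K, e y (m y) &
      forall w, w \in K -> e y w -> w = m y \/ w = q].
  move=> yK; have [r rR yr] := third y yK.
  have [p [q [[pK qK pq yp yq] [rp Ny]]]] := core_third R_hits yK rR yr.
  have ry : e r y by rewrite e_sym.
  have mp : m y = p.
    rewrite /m; case: pickP => /= [w|/(_ p)]; last first.
      by rewrite pK yp; case/existsP; exists r; rewrite rR ry.
    case/and3P=> wK yw /existsP[r' /and3P[r'R r'y r'w]].
    have r'r : r' = r.
      have : e y r' by rewrite e_sym.
      move/Ny; case/or3P => /eqP // E; rewrite E in r'R.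
        by have := core_notin pK; rewrite r'R.
      by have := core_notin qK; rewrite r'R.
    rewrite r'r in r'w.
    case: (nbrs_in_le2 (deg_R r rR) yK pK ry rp (e_neq yp) wK r'w) => // E.
    by rewrite E e_irr in yw.
  exists r, q; rewrite mp; split; first split=> // r' r'R yr'.
    by case/or3P: (Ny r' yr') => /eqP // E; rewrite E in r'R;
      [have := core_notin pK | have := core_notin qK]; rewrite r'R.
  split=> // w wK yw; case/or3P: (Ny w yw) => /eqP E; [by left|by right|].
  by have := core_notin wK; rewrite E rR.
have m_uniq y w r : y \in K -> w \in K -> e y w -> r \in R -> e r y -> e r w ->
    w = m y.
  move=> yK wK yw rR ry rw.
  have [r' [q [[r'R r'y r'm r'_uniq] [mK ym _]]]] := mP y yK.
  have rr' : r = r' by apply: r'_uniq; rewrite // e_sym.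
  rewrite -rr' in r'm.
  case: (nbrs_in_le2 (deg_R r rR) yK mK ry r'm (e_neq ym) wK rw) => // E.
  by rewrite E e_irr in yw.
pose f := [rel x y | [&& e x y, y != m x & x != m y]].
have [||||||c [cm cf]] := @two_colorable_matchings T m f K.
- by move=> y /mP[r [q [_ []]]].
- move=> y yK; have [r [q [[rR ry rm _] [mK ym _]]]] := mP y yK.
  by symmetry; apply: m_uniq rR rm ry => //; rewrite e_sym.
- by move=> y /mP[r [q [_ [_ /e_neq]]]]; rewrite eq_sym.
- by move=> x y; rewrite /= e_sym [X in _ && X]andbC.
- by move=> x _; rewrite /= e_irr.
- move=> x y w xK yK wK /and3P[xy ym _] /and3P[xw wm _].
  have [r [q [_ [_ _ Nx]]]] := mP x xK.
  case: (Nx y yK xy) => E; first by rewrite E eqxx in ym.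
  by case: (Nx w wK xw) => E'; [rewrite E' eqxx in wm | rewrite E].
exists c => x y xK yK xy.
case: (eqVneq y (m x)) => [->|yx]; first by rewrite eq_sym cm.
case: (eqVneq x (m y)) => [->|xm]; first exact: cm.
by apply: cf; rewrite //= xy yx.
Qed.

Lemma valid_two_colorable A B : valid 2 3 A B -> exists A' B',
  valid 2 3 A' B' /\ two_colorable e (~: (A' :|: B')).
Proof.
have [n] := ubnP #|core (A :|: B)|; elim: n A B => // n IHn A B leAB vAB.
have step : improvable 2 3 A B -> exists A' B',
    valid 2 3 A' B' /\ two_colorable e (~: (A' :|: B')).
  case=> A' [B' [v' lt]]; apply: IHn v'.
  by rewrite -ltnS; apply: leq_trans leAB; rewrite ltnS.
pose wide s := 2 < #|nbrs_in e (core (A :|: B)) s|.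
case: (boolP [exists s in B, wide s]) =>
  [/existsP[s /andP[sB]]|/exists_inPn nB].
  by move=> ws; apply/step/(improve_triple_r vAB sB).
have degB : {in B, forall s, #|nbrs_in e (core (A :|: B)) s| <= 2}.
  by move=> s /nB; rewrite -leqNgt.
case: (boolP [exists s in A, wide s]) =>
  [/existsP[s /andP[sA]]|/exists_inPn nA].
  by move=> ws; apply/step/(improve_triple_l vAB sA).
have degA : {in A, forall s, #|nbrs_in e (core (A :|: B)) s| <= 2}.
  by move=> s /nA; rewrite -leqNgt.
have [_ _ _ AB_hits] := vAB.
case: (boolP [forall v in core (A :|: B), [exists r in A :|: B, e v r]]);
  last first.
  case/forall_inPn=> v vK /exists_inPn nv;
    apply/step/(improve_no_neighbor vAB degA vK).
  move=> y vy; apply: (core_closed _ vK vy) => //.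
  by apply/negP=> /nv; rewrite vy.
move/forall_inP=> third; exists A, B; split=> //.
apply: two_colorable_peel => // K KR K2.
have [||c cP] := @two_colorable_core (A :|: B) AB_hits.
- by move=> s; rewrite inE => /orP[/degA|/degB].
- by move=> v /third/exists_inP.
exists c => x y xK yK; have /subsetP KK : K \subset core (A :|: B).
  by apply: sub_core; rewrite // disjoints_subset.
by apply: cP; apply: KK.
Qed.

(** * A first valid pair *)

(** For a complete graph on 4 vertices all vertices are centers; in any other
    component the centers come in adjacent pairs, the middle edges of diamonds. *)
Definition center a := [exists b, exists u, exists v,
  [&& e a b, e a u, e a v, e b u, e b v & u != v]].

Lemma centerP a : reflect
  (exists b u v, [/\ e a b, e a u & e a v] /\ [/\ e b u, e b v & u != v]) (center a).
Proof.
apply: (iffP existsP) => [[b /existsP[u /existsP[v]]]|[b [u [v]]]].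
  by case/and5P=> ab au av bu /andP[bv uv]; exists b, u, v.
case=> -[ab au av] [bu bv uv]; exists b; apply/existsP; exists u;
  apply/existsP; exists v.
by rewrite ab au av bu bv.
Qed.

Lemma center_edge d y : center d -> e d y -> exists2 w, e d w & e y w.
Proof.
case/centerP=> b [u [v [[db du dv] [bu bv uv]]]] dy.
case/or3P: (deg3 db du dv dy (e_neq bu) (e_neq bv) uv) => /eqP->.
- by exists u.
- by exists b; rewrite // e_sym.
by exists b; rewrite // e_sym.
Qed.

Lemma center_third d p q : center d -> exists x, [/\ e d x, x != p & x != q].
Proof.
case/centerP=> b [u [v [[db du dv] [/e_neq bu /e_neq bv uv]]]].
case: (boolP ((b != p) && (b != q))) => [/andP[bp bq]|]; first by exists b.
case: (boolP ((u != p) && (u != q))) => [/andP[up uq]|]; first by exists u.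
rewrite !negb_and !negbK => uE bE; exists v; split=> //; apply/eqP=> vE;
  rewrite vE in uv bv.
  rewrite (negPf uv) (negPf bv) /= in uE bE.
  by rewrite (eqP uE) (eqP bE) eqxx in bu.
rewrite (negPf uv) (negPf bv) !orbF in uE bE.
by rewrite (eqP uE) (eqP bE) eqxx in bu.
Qed.

Section Seed.
Variable D : {set T}.
Hypothesis D_center : {in D, forall d, center d}.
Hypothesis D_max : forall a, center a -> exists2 d, d \in D & near 2 a d.

Definition triangle (t : {set T}) := [exists x, exists y, exists z,
  [&& e x y, e x z, e y z & t == [set x; y; z]]].

Definition free_triangles := [set t : {set T} | triangle t & [disjoint t & D]].

Lemma free_notinD t x : t \in free_triangles -> x \in t -> x \notin D.
Proof. by rewrite inE => /andP[_ /disjointFr] H /H->. Qed.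

Lemma free_at t p : t \in free_triangles -> p \in t -> exists q w,
  [/\ e p q, e p w & e q w] /\ t = [set p; q; w].
Proof.
rewrite inE => /andP[/existsP[x /existsP[y /existsP[z /and4P[xy xz yz /eqP->]]]] _].
rewrite !inE -orbA => /or3P[]/eqP->.
- by exists y, z.
- by exists x, z; rewrite e_sym; split=> //; rewrite (setUC [set y]).
by exists x, y; rewrite ![e z _]e_sym; split=> //; rewrite setUC setUA.
Qed.

Lemma free_card t : t \in free_triangles -> #|t| = 3.
Proof.
move=> tT; have := tT;
  rewrite inE => /andP[/existsP[x /existsP[y /existsP[z t3]]] _].
case/and4P: t3 => /e_neq xy /e_neq xz /e_neq yz /eqP->.
by rewrite -setUA cardsU1 cards2 !inE negb_or xy xz yz.
Qed.

Lemma free_two t p q : t \in free_triangles -> p \in t -> q \in t ->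
  p != q -> exists w,
  [/\ e p q, e p w & e q w] /\ t = [set p; q; w].
Proof.
move=> tT pt qt pq; have [a [b [[pa pb ab] E]]] := free_at tT pt.
move: qt; rewrite E !inE -orbA [q == p]eq_sym (negPf pq) /= => /orP[]/eqP->.
  by exists b.
by exists a; rewrite [e b a]e_sym -setUA [[set a; b]]setUC setUA.
Qed.

Lemma out_uniq t p x y : t \in free_triangles -> p \in t -> e p x -> e p y ->
  x \notin t -> y \notin t -> x = y.
Proof.
move=> tT pt px py; have [a [b [[pa pb ab] ->]]] := free_at tT pt.
rewrite !inE !negb_or => /andP[/andP[xp xa] xb] /andP[/andP[yp ya] yb].
rewrite eq_sym in xa; rewrite eq_sym in xb.
case/or3P: (deg3 pa pb px py (e_neq ab) xa xb) => /eqP //.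
  by move=> E; rewrite E eqxx in ya.
by move=> E; rewrite E eqxx in yb.
Qed.

(** Two triangles with a common edge [p q] make [p] a center, so some [d] in [D] is
    within distance 2 of [p].  All neighbors of [d] lie on triangles with [d], and
    the neighbors of [p] and [q] are known; this leaves only [d = z], and then a
    complete graph on 4 vertices. *)
Lemma two_nbrs_in_triangle t z p q : t \in free_triangles -> z \notin t ->
  p \in t -> q \in t ->
  p != q -> e z p -> e z q -> z \in D /\ forall x, e z x = (x \in t).
Proof.
move=> tT zt pt qt pq zp zq; have [w [[epq pw qw] E]] := free_two tT pt qt pq.
have wt : w \in t by rewrite E !inE eqxx orbT.
have neq_t x y : x \in t -> y \notin t -> x != y.
  by move=> xt; apply: contraNneq => <-.
have pz : e p z by rewrite e_sym.
have qz : e q z by rewrite e_sym.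
have qp : e q p by rewrite e_sym.
have Np x : e p x -> [|| x == q, x == w | x == z].
  by move=> px; apply: (deg3 epq pw pz px (e_neq qw)); apply: neq_t.
have Nq x : e q x -> [|| x == p, x == w | x == z].
  by move=> qx; apply: (deg3 qp qw qz qx (e_neq pw)); apply: neq_t.
have Dt d x : d \in D -> x \in t -> d != x.
  by move=> dD xt; apply: contraTneq dD => ->; apply: free_notinD tT xt.
have Dp d : d \in D -> e d p -> d = z.
  move=> dD; rewrite e_sym => /Np/or3P[]/eqP // E'.
    by have := Dt d q dD qt; rewrite E' eqxx.
  by have := Dt d w dD wt; rewrite E' eqxx.
have Dq d : d \in D -> e d q -> d = z.
  move=> dD; rewrite e_sym => /Nq/or3P[]/eqP // E'.
    by have := Dt d p dD pt; rewrite E' eqxx.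
  by have := Dt d w dD wt; rewrite E' eqxx.
have Dy d y : d \in D -> e d y -> e y p -> e y q -> d = z.
  move=> dD dy yp yq; have [x dx yx] := center_edge (D_center dD) dy.
  have yd : e y d by rewrite e_sym.
  have pd : p != d by rewrite eq_sym Dt.
  have qd : q != d by rewrite eq_sym Dt.
  case/or3P: (deg3 yp yq yd yx pq pd qd) => /eqP xE; rewrite xE in dx.
  - exact: Dp.
  - exact: Dq.
  by rewrite e_irr in dx.
have zD : z \in D.
  have [|d dD] := D_max (a := p).
    by apply/centerP; exists q, w, z; do !split=> //; apply: neq_t.
  case/near2P=> [pd|pd|[y /Np py yd]].
  - by have := Dt d p dD pt; rewrite pd eqxx.
  - by rewrite -(Dp d dD) // e_sym.
  suff <- : d = z by [].
  have dy : e d y by rewrite e_sym.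
  case/or3P: py dy => /eqP->; first exact: Dq.
    by move=> dw; apply: Dy dD dw _ _; rewrite e_sym.
  by move=> dz; apply: Dy dD dz _ _.
have [x [zx xp xq]] := center_third p q (D_center zD).
have px : p != x by rewrite eq_sym.
have qx : q != x by rewrite eq_sym.
have xw : x = w.
  have [y zy xy] := center_edge (D_center zD) zx.
  have zNx : z != x := e_neq zx.
  case/or3P: (deg3 zp zq zx zy pq px qx) => /eqP yE; rewrite {}yE in xy.
  - by rewrite e_sym in xy; case/or3P: (Np x xy) => /eqP // E';
    [rewrite E' eqxx in xq | rewrite E' eqxx in zNx].
  - by rewrite e_sym in xy; case/or3P: (Nq x xy) => /eqP // E';
    [rewrite E' eqxx in xp | rewrite E' eqxx in zNx].
  by rewrite e_irr in xy.
split=> // y; rewrite E !inE -orbA -xw; apply/idP/idP => [zy|/or3P[]/eqP-> //].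
exact: (deg3 zp zq zx zy pq px qx).
Qed.

Lemma D_triangle t d p : t \in free_triangles -> d \in D -> p \in t -> e d p ->
  forall x, e d x = (x \in t).
Proof.
move=> tT dD pt dp; have [y dy py] := center_edge (D_center dD) dp.
have dt : d \notin t by apply: contraTN dD; apply: free_notinD.
have pd : e p d by rewrite e_sym.
case: (boolP (y \in t)) => yt.
  exact: (two_nbrs_in_triangle tT dt pt yt (e_neq py) dp dy).2.
by move: dy; rewrite (out_uniq tT pt pd py dt yt) e_irr.
Qed.

(** Triangles with a common vertex have a common edge, by the degree bound. *)
Lemma free_sub t t' p : t \in free_triangles -> t' \in free_triangles ->
  p \in t -> p \in t' -> t' \subset t.
Proof.
move=> tT t'T pt pt'; have [a [b [[pa pb ab] E]]] := free_at t'T pt'.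
have at' : a \in t' by rewrite E !inE eqxx orbT.
have bt' : b \in t' by rewrite E !inE eqxx orbT.
have both x y : x \in t' -> y \in t' -> e p x -> e p y -> e x y -> x \in t.
  move=> xt' yt' px py xy; apply/negPn/negP=> xt.
  case: (boolP (y \in t)) => yt; last first.
    by rewrite (out_uniq tT pt px py xt yt) e_irr in xy.
  have xp : e x p by rewrite e_sym.
  have [xD _] := two_nbrs_in_triangle tT xt pt yt (e_neq py) xp xy.
  by have := free_notinD t'T xt'; rewrite xD.
apply/subsetP=> x; rewrite E !inE -orbA => /or3P[]/eqP-> //.
  exact: (both a b).
by apply: (both b a); rewrite // e_sym.
Qed.

Lemma free_eq t t' p : t \in free_triangles -> t' \in free_triangles ->
  p \in t -> p \in t' -> t = t'.
Proof.
move=> tT t'T pt pt'; apply/eqP; rewrite eqEsubset.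
by rewrite (free_sub t'T tT pt' pt) (free_sub tT t'T pt pt').
Qed.

Definition link (t s : {set T}) := [exists p in t, exists q in s, near 2 p q].

Lemma linkP (t s : {set T}) : reflect (exists p q, [/\ p \in t, q \in s & near 2 p q]) (link t s).
Proof.
apply: (iffP exists_inP) => [[p pt /exists_inP[q qs pq]]|[p [q [pt qs pq]]]].
  by exists p, q.
by exists p => //; apply/exists_inP; exists q.
Qed.

Lemma link_sym : symmetric link.
Proof.
move=> t s; apply/linkP/linkP=> -[p [q [pt qs pq]]];
  by exists q, p; split=> //; apply: near_sym.
Qed.

Variable I : {set {set T}}.
Hypothesis I_free : I \subset free_triangles.
Hypothesis I_apart : {in I &, forall t s, t != s -> ~~ link t s}.
Hypothesis I_max : {in free_triangles, forall t, t \in I \/ exists2 s, s \in I & link t s}.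
Let C := cover I.

Lemma C_apart t s p q : t \in I -> s \in I -> p \in t -> q \in s ->
  near 2 p q -> t = s.
Proof.
move=> tI sI pt qs pq; apply/eqP/negPn/negP=> ts.
by case/negP: (I_apart tI sI ts); apply/linkP; exists p, q.
Qed.

Lemma CP x : reflect (exists2 t, t \in I & x \in t) (x \in C).
Proof. exact: bigcupP. Qed.

Lemma C_notin_free t x : t \in free_triangles -> t \notin I -> x \in t ->
  x \notin C.
Proof.
move=> tT tI xt; apply: contra tI => /CP[s sI xs].
by rewrite (free_eq tT (subsetP I_free s sI) xt xs).
Qed.

Lemma C_notinD x : x \in C -> x \notin D.
Proof. by case/CP=> t /(subsetP I_free) tT; apply: free_notinD. Qed.

Lemma out_uniq_C r z y : r \in C -> z \notin C -> y \notin C -> e r z ->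
  e r y -> z = y.
Proof.
case/CP=> t tI rt zC yC rz ry; apply: (out_uniq (subsetP I_free t tI) rt rz ry).
  by apply: contra zC => zt; apply/CP; exists t.
by apply: contra yC => yt; apply/CP; exists t.
Qed.

Lemma D_nbrs_C d q x : d \in D -> q \in C -> e d q -> e d x -> x \in C.
Proof.
move=> dD /CP[t tI qt] dq;
  rewrite (D_triangle (subsetP I_free t tI) dD qt dq) => xt.
by apply/CP; exists t.
Qed.

(** A triangle [t] outside [I] offers its vertex [r] to the 2-packing if the
    neighbor [z] of [r] outside [t] belongs to a triangle of [I] or is adjacent
    to a vertex [q] of one. *)
Definition port (t : {set T}) r z q :=
  [&& r \in t, z \notin t, e r z, q \in C & (z == q) || e z q].

Lemma port_exists t : t \in free_triangles -> t \notin I ->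
  exists r z q, port t r z q.
Proof.
move=> tT tI; case: (I_max tT) => [|[s sI /linkP[p [q [pt qs]]]]];
  first by rewrite (negPf tI).
have qC : q \in C by apply/CP; exists s.
have qt : q \notin t by apply: contraTN qC; apply: C_notin_free.
case/near2P=> [pq|pq|[y py yq]].
- by rewrite -pq pt in qt.
- by exists p, q, q; rewrite /port pt qt pq qC eqxx.
case: (boolP (y \in t)) => yt.
  by exists y, q, q; rewrite /port yt qt yq qC eqxx.
by exists p, y, q; rewrite /port pt yt py qC yq orbT.
Qed.

Lemma portP t r z q : t \in free_triangles -> t \notin I -> port t r z q ->
  [/\ r \in t, z \notin t & e r z] /\
    [/\ q \in C, r \notin C, q \notin t & (z \in C) || e z q].
Proof.
move=> tT tI /and5P[rt zt rz qC zq]; do !split=> //.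
- exact: C_notin_free rt.
- by apply: contraTN qC; apply: C_notin_free.
by case/orP: zq => [/eqP->|->]; rewrite ?qC ?orbT.
Qed.

Lemma port_away t r z q t' : t \in free_triangles -> t \notin I ->
  port t r z q ->
  t' \in free_triangles -> t' \notin I -> t != t' -> z \notin t'.
Proof.
move=> tT tI trz t'T t'I tt';
  have [[rt zt rz] [qC rC qt zq]] := portP tT tI trz.
apply/negP=> zt'; have zC := C_notin_free t'T t'I zt';
  rewrite (negPf zC) /= in zq.
have qt' : q \notin t' by apply: contraTN qC; apply: C_notin_free.
have rt' : r \notin t'.
  by apply: contraNN tt' => rt'; rewrite (free_eq tT t'T rt rt').
have zr : e z r by rewrite e_sym.
by rewrite -(out_uniq t'T zt' zq zr qt' rt') qC in rC.
Qed.

(** A common neighbor of [r] and [r'] would be the outer neighbor of both.  It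
    has, besides, a neighbor in a triangle of [I], which gives either a
    vertex of a triangle with two outer neighbors or a claw. *)
Lemma port_near t r z q t' r' z' q' : t \in free_triangles -> t \notin I ->
  port t r z q ->
  t' \in free_triangles -> t' \notin I -> port t' r' z' q' -> t != t' ->
    ~~ near 2 r r'.
Proof.
move=> tT tI trz t'T t'I t'rz tt'.
have [[rt zt rz] [qC rC qt zq]] := portP tT tI trz.
have [[rt' zt' rz'] [qC' rC' qt' zq']] := portP t'T t'I t'rz.
have away := port_away tT tI trz t'T t'I tt'.
have away' : z' \notin t by apply: port_away t'T t'I t'rz _ _ _;
  rewrite // eq_sym.
have rr' : r != r' by apply: contraNneq tt' => E;
  rewrite (free_eq tT t'T rt) ?E.
have r't : r' \notin t by apply: contraNN tt' => H; rewrite (free_eq tT t'T H).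
have no_rr' : ~~ e r r'.
  by apply: contraNN away => H; rewrite (out_uniq tT rt rz H zt r't).
apply/negP => /near2P[E|H|[y ry yr']]; first by rewrite E eqxx in rr'.
  by rewrite H in no_rr'.
have r'y : e r' y by rewrite e_sym.
case: (boolP (y \in t)) => yt.
  have yt' : y \notin t' by apply: contraNN tt' => H;
    rewrite (free_eq tT t'T yt).
  by rewrite -(out_uniq t'T rt' r'y rz' yt' zt') yt in away'.
have yz := out_uniq tT rt ry rz yt zt; rewrite {y yt ry}yz in yr' r'y.
have zr : e z r by rewrite e_sym.
case: (boolP (z \in C)) => zC.
  case/CP: (zC) => s sI zs; have sT := subsetP I_free s sI.
  have out x : x \notin C -> x \notin s.
    by apply: contraNN => xs; apply/CP; exists s.
  by rewrite (out_uniq sT zs zr yr' (out _ rC) (out _ rC')) eqxx in rr'.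
rewrite (negPf zC) /= in zq.
have neq_q x : x \notin C -> x != q by apply: contraNneq => ->.
case/or3P: (claw zr yr' zq rr' (neq_q r rC) (neq_q r' rC')) => H.
- by rewrite H in no_rr'.
- by rewrite (out_uniq tT rt rz H zt qt) qC in zC.
by rewrite (out_uniq t'T rt' r'y H away) ?qC // in zC; apply: contraTN qC;
  apply: C_notin_free.
Qed.

Lemma port_D t r z q d : t \in free_triangles -> t \notin I ->
  port t r z q -> d \in D ->
  ~~ near 2 r d.
Proof.
move=> tT tI trz dD.
have [[rt zt rz] [qC rC qt zq]] := portP tT tI trz.
have dt : d \notin t by apply: contraTN dD; apply: free_notinD.
have dC : d \notin C by apply: contraTN dD; apply: C_notinD.
have rd : r != d by apply: contraNneq dt => <-.
have zr : e z r by rewrite e_sym.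
have no_rd : ~~ e r d.
  apply/negP=> erd; have zd := out_uniq tT rt rz erd zt dt.
  rewrite zd (negPf dC) /= in zq zr.
  by rewrite (D_nbrs_C dD qC zq zr) in rC.
apply/negP => /near2P[E|H|[y ry yd]]; first by rewrite E eqxx in rd.
  by rewrite H in no_rd.
case: (boolP (y \in t)) => yt.
  have dy : e d y by rewrite e_sym.
  by case/negP: no_rd; rewrite e_sym (D_triangle tT dD yt dy).
have yz := out_uniq tT rt ry rz yt zt; rewrite {y yt ry}yz in yd.
case: (boolP (z \in C)) => zC.
  case/CP: (zC) => s sI zs; have sT := subsetP I_free s sI.
  have out x : x \notin C -> x \notin s.
    by apply: contraNN => xs; apply/CP; exists s.
  by rewrite (out_uniq sT zs zr yd (out _ rC) (out _ dC)) eqxx in rd.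
rewrite (negPf zC) /= in zq.
have neq_q x : x \notin C -> x != q by apply: contraNneq => ->.
case/or3P: (claw zr yd zq rd (neq_q r rC) (neq_q d dC)) => H.
- by rewrite H in no_rd.
- by rewrite (out_uniq tT rt rz H zt qt) qC in zC.
by rewrite (D_nbrs_C dD qC H) // e_sym in zC.
Qed.

(** Distance at most 3 between vertices of different triangles of [I], without
    mention of the triangles.  Allowing [r] and [r'] in the same triangle is what
    makes the relation transitive. *)
Definition conflict r r' := (r == r') ||
  [exists z, exists z', [&& z \notin C, z' \notin C, e r z, e z z' & e z' r']].

Lemma conflictP r r' : reflect
  (r = r' \/ exists z z', [/\ z \notin C, z' \notin C, e r z, e z z' & e z' r'])
  (conflict r r').
Proof.
apply: (iffP orP) => [[/eqP|/existsP[z /existsP[z' /and5P[]]]]|[->|[z [z' []]]]].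
- by left.
- by right; exists z, z'.
- by left.
move=> zC z'C rz zz' z'r; right; apply/existsP; exists z; apply/existsP;
  exists z'.
by rewrite zC z'C rz zz'.
Qed.

Lemma conflict_sym r r' : conflict r r' -> conflict r' r.
Proof.
case/conflictP=> [->|[z [z' [zC z'C rz zz' z'r]]]]; apply/conflictP;
  first by left.
by right; exists z', z; rewrite ![e _ z']e_sym ![e _ r]e_sym; split=> //;
  rewrite e_sym.
Qed.

Lemma in_uniq_C z z' r r' : z \notin C -> z' \notin C -> e z z' ->
  r \in C -> r' \in C -> e r z -> e r' z -> r = r'.
Proof.
move=> zC z'C zz' /CP[t tI rt] /CP[t' t'I rt'] rz r'z.
have zr : e z r by rewrite e_sym.
have zr' : e z r' by rewrite e_sym.
have E : t = t' by apply: C_apart tI t'I rt rt' _; apply: near2 rz zr'.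
apply/eqP/negPn/negP=> rr'; rewrite -E in rt'.
have zt : z \notin t by apply: contraNN zC => zt; apply/CP; exists t.
have [_ N] := two_nbrs_in_triangle (subsetP I_free t tI) zt rt rt' rr' zr zr'.
by case/negP: z'C; apply/CP; exists t; rewrite // -N.
Qed.

(** The two paths share the outer neighbor [z'] of [b].  Among [b] and the other
    neighbors [z] and [y] of [z'] there is an edge by claw-freeness, and [b] has
    no second outer neighbor; so [z] and [y] are adjacent or equal. *)
Lemma conflict_trans a b c : a \in C -> b \in C -> c \in C ->
  conflict a b -> conflict b c -> conflict a c.
Proof.
move=> aC bC cC /conflictP[->//|[z [z' [zC z'C az zz' z'b]]]].
case/conflictP=> [<-|[y' [y [y'C yC by' y'y yc]]]].
  by apply/conflictP; right; exists z, z'.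
have bz' : e b z' by rewrite e_sym.
have E := out_uniq_C bC z'C y'C bz' by'; rewrite -{y' by' y'C}E in y'y.
have cy : e c y by rewrite e_sym.
have z'z : e z' z by rewrite e_sym.
case: (eqVneq z y) => [zy|zy].
  rewrite -zy in cy; rewrite (in_uniq_C zC z'C zz' aC cC az cy).
  by apply/conflictP; left.
have neq_b x : x \notin C -> x != b by apply: contraNneq => ->.
have out x : x \notin C -> e z' x -> ~~ e x b.
  move=> xC z'x; apply/negP=> xb; have bx : e b x by rewrite e_sym.
  by move: z'x; rewrite (out_uniq_C bC xC z'C bx bz') e_irr.
have := claw z'z y'y z'b zy (neq_b z zC) (neq_b y yC).
rewrite (negPf (out z zC z'z)) (negPf (out y yC y'y)) !orbF => zy'.
by apply/conflictP; right; exists z, y.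
Qed.

Lemma near3_conflict t s r r' : t \in I -> s \in I -> t != s -> r \in t ->
  r' \in s -> near 3 r r' -> conflict r r'.
Proof.
move=> tI sI ts rt r's.
have apart x y : x \in t -> y \in s -> ~~ near 2 x y.
  move=> xt ys; apply: contraNN ts => xy; apply/eqP.
  exact: C_apart tI sI xt ys xy.
case/nearSP=> [->|[y ry yr']]; first by apply/conflictP; left.
have yC : y \notin C.
  apply/negP=> /CP[b bI yb].
  have E : t = b by apply: C_apart tI bI rt yb _; apply/nearW/near1.
  by rewrite -E in yb; case/negP: (apart y r' yb r's).
case/near2P: (yr') => [E|yr|[w yw wr']].
- by case/negP: yC; apply/CP; exists s; rewrite ?E.
- by case/negP: (apart r r' rt r's); apply: near2 ry yr.
have wC : w \notin C.
  apply/negP=> /CP[b bI wb].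
  have E : b = s by apply: C_apart bI sI wb r's _; apply/nearW/near1.
  by rewrite E in wb; case/negP: (apart r w rt wb); apply: near2 ry yw.
by apply/conflictP; right; exists y, w.
Qed.

Definition conflicts r := [set r' in C | conflict r r'].

Lemma conflicts_eq r r' : r \in C -> r' \in C -> conflict r r' ->
  conflicts r = conflicts r'.
Proof.
move=> rC r'C rr'; apply/setP=> x; rewrite !inE.
case: (boolP (x \in C)) => //= xC; apply/idP/idP; last exact: conflict_trans.
by apply: conflict_trans => //; apply: conflict_sym.
Qed.

(** The members other than [r] are reached through distinct neighbors of the
    outer neighbor of [r], which has at most two neighbors besides [r]. *)
Lemma card_conflicts r : r \in C -> #|conflicts r| <= 3.
Proof.
move=> rC.
case: (boolP [exists z, (z \notin C) && e r z]) =>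
  [/existsP[z /andP[zC rz]]|no].
  pose N := [set y | e z y]; pose g y := odflt r [pick x in C | e y x].
  have rN : r \in N by rewrite inE e_sym.
  have sub : conflicts r \subset r |: g @: (N :\ r).
    apply/subsetP=> x; rewrite !inE => /andP[xC /conflictP[->|]];
      first by rewrite eqxx.
    case=> w [w' [wC w'C rw ww' w'x]]; apply/orP; right.
    rewrite (out_uniq_C rC wC zC rw rz) in ww'.
    apply/imsetP; exists w'.
      by rewrite !inE ww' andbT; apply: contraNneq w'C => ->.
    rewrite /g; case: pickP => [y /andP[yC w'y]|/(_ x)] /=;
      last by rewrite xC w'x.
    by apply: (in_uniq_C w'C zC); rewrite // e_sym.
  apply: leq_trans (subset_leq_card sub) _.
  apply: leq_trans (leq_card_setU _ _) _; rewrite cards1 add1n ltnS.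
  apply: leq_trans (leq_imset_card _ _) _.
  by rewrite -ltnS; apply: leq_trans (deg_le3 z);
    rewrite (cardsD1 r [set y | e z y]) rN.
have sub : conflicts r \subset [set r].
  apply/subsetP=> x; rewrite !inE => /andP[_ /conflictP[->//|]].
  case=> z [z' [zC _ rz _ _]]; case/negP: no; apply/existsP; exists z.
  by rewrite zC rz.
by apply: leq_trans (subset_leq_card sub) _; rewrite cards1.
Qed.

Hypothesis D_packed : packed 2 D.

Lemma valid_of_packings (x0 : T) : exists A B, valid 2 3 A B.
Proof.
have trivI : trivIset I.
  apply/trivIsetP=> t s tI sI; apply: contraNT => /pred0Pn[x /andP[xt xs]].
  by apply/eqP; apply: free_eq xt xs; apply: (subsetP I_free).
have [||f [fI f_inj]] :=
  @regular_transversal T {set T} x0 I conflicts 3 isT trivI.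
- by move=> t tI; rewrite (free_card (subsetP I_free t tI)).
- move=> x xC; apply: leq_trans (card_conflicts xC); apply: subset_leq_card.
  apply/subsetP=> y; rewrite inE => /andP[yC /eqP<-].
  by rewrite inE yC; apply/conflictP; left.
pose rho (t : {set T}) :=
  odflt x0 [pick r in t | [exists z, exists q, port t r z q]].
have rhoP t : t \in free_triangles -> t \notin I ->
  exists z q, port t (rho t) z q.
  move=> tT tI; rewrite /rho;
    case: pickP => [r /andP[_ /existsP[z /existsP[q trz]]]|no].
    by exists z, q.
  have [r [z [q trz]]] := port_exists tT tI; have := no r.
  have /and5P[-> _ _ _ _] := trz.
  by rewrite /= => /negbT/negP[]; apply/existsP; exists z; apply/existsP;
    exists q.
pose X := rho @: (free_triangles :\: I); exists (D :|: X), (f @: I).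
have XP x : x \in X -> exists t z q,
  [/\ t \in free_triangles, t \notin I, x = rho t & port t x z q].
  case/imsetP=> t; rewrite inE => /andP[tI tT] ->.
  by have [z [q trz]] := rhoP t tT tI; exists t, z, q.
split.
- rewrite disjoints_subset; apply/subsetP=> x xDX; rewrite inE.
  apply/negP=> /imsetP[t tI xE]; have xt : x \in t by rewrite xE fI.
  have tT := subsetP I_free t tI;
    case/setUP: xDX => [xD|/XP[s [z [q [sT sI _]]]]].
    by have := free_notinD tT xt; rewrite xD.
  case/(portP sT sI)=> [[xs _ _] _]; have := C_notin_free sT sI xs.
  by case/negP; apply/CP; exists t.
- move=> x y; rewrite !in_setU => /orP[xD|/XP[t [z [q [tT tI xE trz]]]]].
    case/orP=> [yD|/XP[s [w [q [sT sI yE swq]]]]] xy; first exact: D_packed.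
    by apply/negP=> /(near_sym); apply/negP; apply: port_D swq xD.
  case/orP=> [yD|/XP[s [w [q' [sT sI yE swq]]]]] xy; first exact: port_D trz yD.
  by apply: port_near trz _ _ swq _ => //; apply: contraNneq xy => E;
    rewrite xE yE E.
- move=> x y /imsetP[t tI ->] /imsetP[s sI ->] xy; apply/negP => H.
  have ts : t != s by apply: contraNneq xy => ->.
  have fC u : u \in I -> f u \in C by move=> uI; apply/CP; exists u;
    rewrite ?fI.
  have := near3_conflict tI sI ts (fI t tI) (fI s sI) H.
  move/(conflicts_eq (fC t tI) (fC s sI)) => E.
  by rewrite (f_inj t s tI sI E) eqxx in ts.
move=> x y z xy xz yz; set t := [set x; y; z].
have tP u : u \in t -> u \in (D :|: X) :|: f @: I ->
   [|| x \in (D :|: X) :|: f @: I, y \in (D :|: X) :|: f @: I | z \in (D :|: X) :|: f @: I].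
  by rewrite /t in_setU in_setU !in_set1 -orbA => /or3P[]/eqP-> ->;
    rewrite ?orbT.
case: (boolP [disjoint t & D]) => [tD|/pred0Pn[u /andP[ut uD]]]; last first.
  have uD' : u \in D := uD; by apply: (tP u ut); rewrite !in_setU uD'.
have tT : t \in free_triangles.
  rewrite inE tD andbT; apply/existsP; exists x; apply/existsP; exists y.
  by apply/existsP; exists z; rewrite xy xz yz eqxx.
case: (boolP (t \in I)) => tI.
  by apply: (tP (f t) (fI t tI)); rewrite in_setU imset_f ?orbT.
have [w [q /and5P[rt _ _ _ _]]] := rhoP t tT tI.
apply: (tP (rho t) rt); rewrite !in_setU imset_f ?orbT // inE tI.
exact: tT.
Qed.

End Seed.

Lemma exists_valid : exists A B, valid 2 3 A B.
Proof.
case: (pickP T) => [x0 _|T0]; last first.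
  exists set0, set0; split=> [|x|x|x]; rewrite ?inE //; last by have := T0 x.
  by rewrite disjoints_subset sub0set.
have near2_sym : symmetric (near 2) by move=> x y; apply/idP/idP;
  apply: near_sym.
have [D [Dc D_packed Dmax]] := maximal_independent [set a | center a] near2_sym.
have D_center : {in D, forall d, center d}.
  by move=> d /(subsetP Dc); rewrite inE.
have D_max a : center a -> exists2 d, d \in D & near 2 a d.
  move=> ca; have [|aD|//] := Dmax a; first by rewrite inE.
  by exists a => //; apply: near_refl.
have [I [I_free I_apart I_max]] :=
  maximal_independent (free_triangles D) link_sym.
exact: (valid_of_packings D_center D_max I_free I_apart I_max D_packed x0).
Qed.

End ClawFreeSubcubic.

(** * Packing colorings *)

Lemma dist_gt_near (T : finType) (e : rel T) k x y :
  ~~ near e k x y -> dist_gt e x y k.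
Proof.
move=> far; apply/dist_gtP => p xp py; rewrite ltnNge; apply: contra far.
by rewrite -py; apply: near_path.
Qed.

Theorem theorem3 (T : finType) (e : rel T)
    (e_sym : symmetric e) (e_irr : irreflexive e)
    (e_subcubic : subcubic e) (e_claw_free : claw_free e) :
  packing_colorable e [:: 1; 1; 2; 3].
Proof.
have deg_le3 x : #|[set y | e x y]| <= 3.
  by apply: leq_trans e_subcubic; apply: (leq_bigmax (F := degree e)).
have [A0 [B0 v0]] := exists_valid e_sym e_irr deg_le3 e_claw_free.
have [A [B [[_ A_packed B_packed _] [c c_proper]]]] :=
  valid_two_colorable e_sym e_irr deg_le3 e_claw_free v0.
pose col x := if x \in A then 2 else if x \in B then 3 else c x : nat.
have col_lt x : col x < 4.
  by rewrite /col; case: (x \in A); case: (x \in B); case: (c x).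
exists (fun i : 'I_4 => [set x | col x == i]); split.
- apply/setP=> x; rewrite inE; apply/bigcupP; exists (Ordinal (col_lt x)) => //.
  by rewrite inE.
- move=> i j ij; apply/pred0P=> x /=; rewrite !inE; apply: contraNF ij.
  by case/andP=> /eqP xi /eqP xj; rewrite -val_eqE /= -xi xj.
move=> i x y; rewrite !inE => /eqP<- /eqP xy x_neq_y; apply: dist_gt_near.
move: xy; rewrite /col; case: (boolP (x \in A)) => xA.
  case: (boolP (y \in A)) => [yA _|_]; first exact: A_packed.
  by case: (y \in B); case: (c y).
case: (boolP (x \in B)) => xB.
  case: (boolP (y \in A)) => // yA; case: (boolP (y \in B)) => [yB _|_].
    exact: B_packed.
  by case: (c y).
case: (boolP (y \in A)) => yA; first by case: (c x).
case: (boolP (y \in B)) => yB; first by case: (c x).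
move=> cxy; have {}cxy : c x = c y by move: cxy; case: (c x); case: (c y).
have -> : nth 0 [:: 1; 1; 2; 3] (c x) = 1 by case: (c x).
apply/negP=> /near1P[E|exy]; first by rewrite E eqxx in x_neq_y.
by have := c_proper x y;
  rewrite !inE (negPf xA) (negPf xB) (negPf yA) (negPf yB) cxy eqxx =>
    /(_ isT isT exy).
Qed.
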